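(* Let $\varphi:\mathbb{D}\to\mathbb{C}$ be a function and let $\mathcal{H}_k$ be a truncated space with orthonormal basis $\{f_m\}_{m\ge0}$, $f_m(z) = (1 + b_m z)z^m$, where $b_t = 0$ for all $t \ge n$. Then $\varphi$ is a multiplier of $\mathcal{H}_k$ (i.e. $\varphi\mathcal{H}_k \subseteq \mathcal{H}_k$) if and only if $\varphi \in H^\infty(\mathbb{D})$.
   Context: Fix $n \ge 1$. A truncated space is a reproducing kernel Hilbert space $\mathcal{H}_k$ of analytic functions on the open unit disc $\mathbb{D}$ (with scalar analytic kernel $k$) such that: $\mathbb{C}[z]\subseteq\mathcal{H}_k$; the multiplication operator $M_z$ is bounded on $\mathcal{H}_k$; and the functions $f_m(z) = (1 + b_m z)z^m$, $m \ge 0$, form an orthonormal basis of $\mathcal{H}_k$, for scalars $\{b_m\}_{m\ge0}$ with $b_t = 0$ for all $t \ge n$. $H^\infty(\mathbb{D})$ denotes the bounded analytic functions on $\mathbb{D}$. *)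

(* Defs.v *)
From Stdlib Require Import Reals.
From Coquelicot Require Import Coquelicot.
Open Scope R_scope.

Definition in_disc (z : C) : Prop := Cmod z < 1.

Fixpoint Cpown (z : C) (m : nat) : C :=
  match m with O => 1%C | S k => Cmult z (Cpown z k) end.

Definition fbasis (b : nat -> C) (m : nat) (z : C) : C :=
  Cmult (Cplus 1%C (Cmult (b m) z)) (Cpown z m).

(* The truncated space H_k determined by b: the functions on D of the form
   sum_m c_m f_m with (c_m) square-summable (the f_m being orthonormal,
   these are exactly the elements of the Hilbert space). *)
Definition in_trunc_space (b : nat -> C) (g : C -> C) : Prop :=
  exists c : nat -> C,
    ex_series (fun m => (Cmod (c m)) ^ 2) /\
    forall z, in_disc z -> is_series (fun m => Cmult (c m) (fbasis b m z)) (g z).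

Definition is_multiplier (b : nat -> C) (phi : C -> C) : Prop :=
  forall g, in_trunc_space b g -> in_trunc_space b (fun z => Cmult (phi z) (g z)).

Definition in_Hinfty (phi : C -> C) : Prop :=
  (forall z, in_disc z -> ex_derive (K := C_AbsRing) (V := C_NormedModule) phi z) /\
  exists M : R, forall z, in_disc z -> Cmod (phi z) <= M.

(* Main.v *)
Require Import Defs.
From Stdlib Require Import Reals ZArith Lra Lia ClassicalEpsilon.
From Coquelicot Require Import Coquelicot.
Open Scope R_scope.

(** Since [b] vanishes eventually, passing from the coefficients in the basis
    [(f_m)] to Taylor coefficients is a triangular change affecting finitely
    many of them, so the truncated space is, as a set, the Hardy space [H^2] of
    power series with square-summable coefficients.

    A multiplier [phi = phi * 1] is then such a power series, hence holomorphic.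
    The functional [f |-> phi(w) f(w) / ||k_w||], with [k_w] the Szego kernel, has
    norm [|phi(w)|] and is bounded by [||phi f||] at each [f]; uniform boundedness,
    obtained by a gliding hump in [sum +-3^-j k_(w_j) / ||k_(w_j)||], bounds [phi].

    Conversely, if [phi] is bounded holomorphic and [f] is in [H^2], then [g = phi f]
    is holomorphic with bounded square means on circles. Goursat's theorem for
    [g(e^w) e^(-m w)] on rectangles of height [2 pi] shows that the [m]-th Fourier
    coefficient of [g] on the circle of radius [r] is [d_m r^m]. Bessel's inequality
    makes [(d_m)] square-summable with [d_m = 0] for [m < 0], and Chernoff's
    telescoping argument shows that [g] is the sum of its Taylor series. *)

(** Holomorphy is given only as complex differentiability at each point of the disc, with no
    continuity of the derivative and no local expansion; this is why Goursat's bisection is carried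
    out. In the coordinate w = log z circles become vertical segments, so rectangles suffice, at the
    price of losing the point 0, which is recovered at the end by continuity. Bessel controls the
    size of the coefficients but not convergence at a given point, hence the separate telescoping
    argument. In the gliding hump the ratio 3 makes all later terms together weigh at most 3^-j / 2,
    half of the j-th one, and points with |phi(w_j)| >= 4^j then force growth like (4/3)^j. *)

Ltac Cring := match goal with |- @eq _ ?a ?b => change (@eq C a b) end; ring.

Lemma choice_fun (A B : Type) (P : A -> B -> Prop) :
  (forall x, exists y, P x y) -> exists f : A -> B, forall x, P x (f x).
Proof.
  intros H. exists (fun x => proj1_sig (constructive_indefinite_description _ (H x))).
  intros x. exact (proj2_sig (constructive_indefinite_description _ (H x))).
Qed.

(** * Complex series and power series with bounded coefficients *)

Lemma is_Cseries_eps (a : nat -> C) (l : C) :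
  is_series a l <->
  forall eps, 0 < eps ->
    exists N, forall n, (N <= n)%nat -> Cmod (sum_n a n - l)%C < eps.
Proof.
  unfold is_series.
  rewrite (filterlim_locally_ball_norm (U := C_NormedModule)).
  split.
  - intros H eps He. exact (H (mkposreal eps He)).
  - intros H eps. exact (H eps (cond_pos eps)).
Qed.

Lemma Cmod_triangle_sub (x y : C) : Cmod (x - y)%C <= Cmod x + Cmod y.
Proof.
  replace (x - y)%C with (x + - y)%C by ring.
  rewrite <- (Cmod_opp y). apply Cmod_triangle.
Qed.

Lemma Rle_plus_eps (x y : R) : (forall eps, 0 < eps -> x <= y + eps) -> x <= y.
Proof.
  intros H. destruct (Rle_or_lt x y) as [h|h]; [exact h|].
  specialize (H ((x - y) / 2)). lra.
Qed.

Lemma Cseries_norm_le (a : nat -> C) (l : C) (K : R) :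
  is_series a l -> (forall N, Cmod (sum_n a N) <= K) -> Cmod l <= K.
Proof.
  intros H HK. apply Rle_plus_eps. intros eps He.
  destruct (proj1 (is_Cseries_eps a l) H eps He) as [N HN].
  specialize (HN N (le_n N)). specialize (HK N).
  pose proof (Cmod_triangle_sub (sum_n a N) (sum_n a N - l)%C) as T.
  replace (sum_n a N - (sum_n a N - l))%C with l in T by (unfold Cminus; ring).
  lra.
Qed.

Lemma Cseries_unique (a : nat -> C) (l1 l2 : C) :
  is_series a l1 -> is_series a l2 -> l1 = l2.
Proof.
  intros H1 H2.
  exact (filterlim_locally_unique (F := eventually) (V := C_NormedModule) (sum_n a) l1 l2 H1 H2).
Qed.

Lemma Cmod_sum_n_le (a : nat -> C) (N : nat) :
  Cmod (sum_n a N) <= sum_n (fun m => Cmod (a m)) N.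
Proof. exact (norm_sum_n_m (V := C_NormedModule) a 0 N). Qed.

Lemma Cmod_pown (z : C) (m : nat) : Cmod (Cpown z m) = Cmod z ^ m.
Proof.
  induction m as [|m IH]; simpl.
  - apply Cmod_1.
  - rewrite Cmod_mult, IH. reflexivity.
Qed.

Lemma sum_n_nonneg (u : nat -> R) (N : nat) :
  (forall m, 0 <= u m) -> 0 <= sum_n u N.
Proof.
  intros H. induction N as [|N IH].
  - rewrite sum_O. apply H.
  - rewrite sum_Sn. apply Rplus_le_le_0_compat; [exact IH|apply H].
Qed.

Lemma sum_n_le_series (u : nat -> R) (l : R) (N : nat) :
  (forall m, 0 <= u m) -> is_series u l -> sum_n u N <= l.
Proof.
  intros H Hl.
  assert (Hm : forall k, sum_n u N <= sum_n u (k + N)).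
  { induction k as [|k IH]; [apply Rle_refl|].
    change (S k + N)%nat with (S (k + N)). rewrite sum_Sn. specialize (H (S (k + N))).
    unfold plus; simpl. lra. }
  assert (Hlim : is_lim_seq (fun k => sum_n u (k + N)) l).
  { apply (is_lim_seq_incr_n (fun k => sum_n u k) N). exact Hl. }
  exact (is_lim_seq_le _ _ _ _ Hm (is_lim_seq_const _) Hlim).
Qed.

Definition powser (c : nat -> C) (z : C) : nat -> C := fun m => (c m * Cpown z m)%C.

(** Comparison with a geometric series. Bounded coefficients are the working hypothesis for power
    series: square-summable ones are bounded, and boundedness passes to tails and difference
    quotients with explicit constants. *)
Lemma ex_series_powser (c : nat -> C) (B : R) (z : C) :
  (forall m, Cmod (c m) <= B) -> in_disc z ->
  ex_series (V := C_NormedModule) (powser c z).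
Proof.
  intros HB Hz.
  apply (ex_series_le (V := C_CompleteNormedModule) _ (fun m => scal B (Cmod z ^ m))).
  - intros m. change (Cmod (c m * Cpown z m)%C <= B * Cmod z ^ m).
    rewrite Cmod_mult, Cmod_pown. apply Rmult_le_compat_r.
    + apply pow_le, Cmod_ge_0.
    + apply HB.
  - apply (ex_series_scal (V := R_NormedModule) B). exists (/ (1 - Cmod z)). apply is_series_geom.
    rewrite Rabs_pos_eq; [exact Hz|apply Cmod_ge_0].
Qed.

Lemma powser_bound (c : nat -> C) (B : R) (z l : C) :
  (forall m, Cmod (c m) <= B) -> in_disc z -> is_series (powser c z) l ->
  Cmod l <= B / (1 - Cmod z).
Proof.
  intros HB Hz Hl. apply (Cseries_norm_le _ _ _ Hl). intros N.
  eapply Rle_trans; [apply Cmod_sum_n_le|].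
  assert (HB0 : 0 <= B) by (eapply Rle_trans; [apply Cmod_ge_0|apply (HB 0%nat)]).
  apply Rle_trans with (sum_n (fun m => scal B (Cmod z ^ m)) N).
  - apply sum_n_m_le. intros m. change (Cmod (c m * Cpown z m)%C <= B * Cmod z ^ m).
    rewrite Cmod_mult, Cmod_pown. apply Rmult_le_compat_r.
    + apply pow_le, Cmod_ge_0.
    + apply HB.
  - apply sum_n_le_series.
    + intros m. apply Rmult_le_pos; [exact HB0|apply pow_le, Cmod_ge_0].
    + apply (is_series_scal (V := R_NormedModule) B). apply is_series_geom.
      rewrite Rabs_pos_eq; [exact Hz|apply Cmod_ge_0].
Qed.

(* The sum of a complex series, with value [0] when the series diverges. *)
Definition Csum (a : nat -> C) : C :=
  epsilon (inhabits (RtoC 0))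
    (fun l : C => is_series (V := C_NormedModule) a l \/
      ~ ex_series (V := C_NormedModule) a /\ l = 0%C).

Lemma Csum_correct (a : nat -> C) :
  ex_series (V := C_NormedModule) a -> is_series a (Csum a).
Proof.
  intros [l Hl]. unfold Csum.
  assert (H : exists l : C, is_series (V := C_NormedModule) a l \/
      ~ ex_series (V := C_NormedModule) a /\ l = 0%C) by (exists l; left; exact Hl).
  destruct (epsilon_spec (inhabits (RtoC 0)) _ H) as [h|[h _]]; [exact h|].
  exfalso. apply h. exists l. exact Hl.
Qed.

Lemma powser_correct (c : nat -> C) (B : R) (z : C) :
  (forall m, Cmod (c m) <= B) -> in_disc z ->
  is_series (powser c z) (Csum (powser c z)).
Proof. intros HB Hz. apply Csum_correct. apply (ex_series_powser c B z HB Hz). Qed.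

Lemma Csum_eq (a : nat -> C) (l : C) : is_series a l -> Csum a = l.
Proof.
  intros H. apply (Cseries_unique a); [|exact H].
  apply Csum_correct. exists l. exact H.
Qed.

Lemma Cseries_scal (k : C) (a : nat -> C) (l : C) :
  is_series a l -> is_series (fun m => (k * a m)%C) (k * l)%C.
Proof. exact (is_series_scal (V := C_NormedModule) k a l). Qed.

Lemma Cseries_plus (a b : nat -> C) (la lb : C) :
  is_series a la -> is_series b lb -> is_series (fun m => (a m + b m)%C) (la + lb)%C.
Proof. exact (is_series_plus (V := C_NormedModule) a b la lb). Qed.

Lemma Cseries_minus (a b : nat -> C) (la lb : C) :
  is_series a la -> is_series b lb -> is_series (fun m => (a m - b m)%C) (la - lb)%C.
Proof. exact (is_series_minus (V := C_NormedModule) a b la lb). Qed.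

Lemma Cseries_cons (a : nat -> C) (l : C) :
  is_series (fun m => a (S m)) l -> is_series a (a 0%nat + l)%C.
Proof.
  intros H. apply (is_series_decr_1 (V := C_NormedModule)).
  refine (eq_ind l (fun t => is_series (V := C_NormedModule) _ t) H _ _).
  change (l = (a 0%nat + l) + - a 0%nat)%C. ring.
Qed.

Lemma powser_cons (c : nat -> C) (z l : C) :
  is_series (powser (fun m => c (S m)) z) l ->
  is_series (powser c z) (c 0%nat + z * l)%C.
Proof.
  intros H.
  replace (c 0%nat) with (powser c z 0%nat) by (unfold powser; simpl; ring).
  apply Cseries_cons.
  apply is_series_ext with (2 := Cseries_scal z _ _ H).
  intros m. unfold powser. simpl. Cring.
Qed.

(** The tail from index m divided by z^m. In this form the recursion T_m = c_m + z T_(m+1) holds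
    without division, also at z = 0. *)
Definition powser_tail (c : nat -> C) (z : C) (m : nat) : C :=
  Csum (powser (fun j => c (m + j)%nat) z).

Lemma powser_tail_bound (c : nat -> C) (B : R) (z : C) :
  (forall m, Cmod (c m) <= B) -> in_disc z ->
  forall m, Cmod (powser_tail c z m) <= B / (1 - Cmod z).
Proof.
  intros HB Hz m.
  apply (powser_bound (fun j => c (m + j)%nat)); [intros; apply HB|exact Hz|].
  apply (powser_correct _ B); [intros; apply HB|exact Hz].
Qed.

Lemma powser_tail_step (c : nat -> C) (B : R) (z : C) :
  (forall m, Cmod (c m) <= B) -> in_disc z ->
  forall m, powser_tail c z m = (c m + z * powser_tail c z (S m))%C.
Proof.
  intros HB Hz m. unfold powser_tail. apply Csum_eq.
  replace (c m) with (c (m + 0)%nat) by (f_equal; lia).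
  apply (powser_cons (fun j => c (m + j)%nat)).
  apply is_series_ext with (powser (fun j => c (S m + j)%nat) z).
  - intros j. unfold powser. do 2 f_equal. lia.
  - apply (powser_correct _ B); [intros; apply HB|exact Hz].
Qed.

Lemma powser_tail_split (c : nat -> C) (B : R) (z : C) (N : nat) :
  (forall m, Cmod (c m) <= B) -> in_disc z ->
  Csum (powser c z) = (sum_n (powser c z) N + Cpown z (S N) * powser_tail c z (S N))%C.
Proof.
  intros HB Hz. change (Csum (powser c z)) with (powser_tail c z 0).
  induction N as [|N IH].
  - rewrite sum_O, (powser_tail_step c B z HB Hz 0). unfold powser. simpl. Cring.
  - rewrite IH, sum_Sn, (powser_tail_step c B z HB Hz (S N)).
    set (s := sum_n (powser c z) N : C). unfold plus, powser. simpl. Cring.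
Qed.

(* The difference quotient of a power series at [z0] is again a power series
   with bounded coefficients, so it can be expanded at [z0] once more. *)
Definition quotient_coef (c : nat -> C) (z0 : C) (m : nat) : C := powser_tail c z0 (S m).

Lemma quotient_coef_bound (c : nat -> C) (B : R) (z0 : C) :
  (forall m, Cmod (c m) <= B) -> in_disc z0 ->
  forall m, Cmod (quotient_coef c z0 m) <= B / (1 - Cmod z0).
Proof. intros HB Hz m. apply powser_tail_bound; assumption. Qed.

(** Synthetic division: with T_m the tails at [z0], c_m = T_m - z0 T_(m+1), so the series at [z] is
    the difference of the series with coefficients T_m and z0 times the one with coefficients
    T_(m+1). *)
Lemma powser_factor (c : nat -> C) (B : R) (z0 z : C) :
  (forall m, Cmod (c m) <= B) -> in_disc z0 -> in_disc z ->
  Csum (powser c z) =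
  (Csum (powser c z0) + (z - z0) * Csum (powser (quotient_coef c z0) z))%C.
Proof.
  intros HB Hz0 Hz.
  set (T := powser_tail c z0).
  assert (HT := powser_tail_step c B z0 HB Hz0 : forall m, T m = (c m + z0 * T (S m))%C).
  assert (HQ : is_series (powser (fun m => T (S m)) z)
                 (Csum (powser (quotient_coef c z0) z))).
  { apply (powser_correct _ (B / (1 - Cmod z0)));
      [apply quotient_coef_bound; assumption|exact Hz]. }
  set (Q := Csum (powser (quotient_coef c z0) z)) in *.
  assert (E : (Csum (powser c z0) + (z - z0) * Q = (T 0%nat + z * Q) - z0 * Q)%C).
  { change (T 0%nat) with (Csum (powser c z0)). ring. }
  rewrite E. apply Csum_eq.
  apply is_series_ext with (2 := Cseries_minus _ _ _ _ (powser_cons T z _ HQ)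
     (Cseries_scal z0 _ _ HQ)).
  intros m. unfold powser. rewrite (HT m). Cring.
Qed.

(** * Complex differentiability *)

(** The non-strict bound makes the condition hold trivially at w = z, so no quotient and no
    exceptional point occur. *)
Definition cderiv (g : C -> C) (z l : C) : Prop :=
  forall eps, 0 < eps -> exists delta, 0 < delta /\
    forall w, Cmod (w - z)%C < delta ->
      Cmod (g w - g z - l * (w - z))%C <= eps * Cmod (w - z)%C.

(** The product and chain rules are applied in the module structure of C over itself as an absolute
    ring, while [in_Hinfty] uses [C_NormedModule]; [cderiv] is the neutral form between the two. *)
Lemma cderiv_is_derive_ring (g : C -> C) (z l : C) :
  cderiv g z l <->
  is_derive (K := C_AbsRing) (V := AbsRing_NormedModule C_AbsRing) g z l.
Proof.
  assert (E : forall w, Cmod (g w - g z - l * (w - z))%C =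
    norm (V := AbsRing_NormedModule C_AbsRing)
      (minus (minus (g w) (g z)) (scal (minus (w : AbsRing_NormedModule C_AbsRing) z) l))).
  { intros w.
    change (Cmod (g w - g z - l * (w - z)) = Cmod (g w - g z - (w - z) * l))%C.
    f_equal. ring. }
  split.
  - intros H. split; [apply is_linear_scal_l|].
    intros x Hx.
    assert (z = x) as <-.
    { apply (is_filter_lim_locally_unique (K := C_AbsRing)
        (V := AbsRing_NormedModule C_AbsRing) z x Hx). }
    intros eps. destruct (H eps (cond_pos eps)) as [d [Hd H']].
    exists (mkposreal d Hd). intros w Hw.
    rewrite <- E. apply H'. exact Hw.
  - intros [_ H] eps He.
    destruct (H z (fun P HP => HP) (mkposreal eps He)) as [d Hd].
    exists d. split; [apply cond_pos|].
    intros w Hw. rewrite E. apply Hd. exact Hw.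
Qed.

Lemma cderiv_is_derive (g : C -> C) (z l : C) :
  cderiv g z l <-> is_derive (K := C_AbsRing) (V := C_NormedModule) g z l.
Proof.
  rewrite cderiv_is_derive_ring.
  split; intros [_ H]; (split; [apply is_linear_scal_l|exact H]).
Qed.

Lemma cderiv_ext_disc (f g : C -> C) (z l : C) :
  in_disc z -> (forall w, in_disc w -> f w = g w) -> cderiv f z l -> cderiv g z l.
Proof.
  intros Hz E H eps He. destruct (H eps He) as [d [Hd H']].
  exists (Rmin d (1 - Cmod z)). unfold in_disc in Hz.
  split; [apply Rmin_glb_lt; lra|].
  intros w Hw. pose proof (Rmin_l d (1 - Cmod z)). pose proof (Rmin_r d (1 - Cmod z)).
  rewrite <- E, <- (E z); [apply H'; lra|exact Hz|].
  unfold in_disc. pose proof (Cmod_triangle z (w - z)%C) as T.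
  replace (z + (w - z))%C with w in T by ring. lra.
Qed.

(** Factoring twice at [z0] turns the first-order remainder into (w - z0)^2 times a power series
    with bounded coefficients, hence one bounded near [z0]. *)
Lemma cderiv_powser (c : nat -> C) (B : R) (z0 : C) :
  (forall m, Cmod (c m) <= B) -> in_disc z0 ->
  exists l, cderiv (fun z => Csum (powser c z)) z0 l.
Proof.
  intros HB Hz0. exists (Csum (powser (quotient_coef c z0) z0)).
  set (B1 := B / (1 - Cmod z0)). set (c1 := quotient_coef c z0).
  assert (HB1 : forall m, Cmod (c1 m) <= B1) by (apply quotient_coef_bound; assumption).
  set (B2 := B1 / (1 - Cmod z0)). set (c2 := quotient_coef c1 z0).
  assert (HB2 : forall m, Cmod (c2 m) <= B2) by (apply quotient_coef_bound; assumption).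
  assert (HB20 : 0 <= B2) by (eapply Rle_trans; [apply Cmod_ge_0|apply (HB2 0%nat)]).
  assert (Hr : 0 < 1 - Cmod z0) by (unfold in_disc in Hz0; lra).
  set (rho := (1 - Cmod z0) / 2).
  (* The bound [rho] keeps |w| below 1 - rho, where the second quotient is at most B2 / rho; the
     other bound makes |w - z0| B2 / rho at most eps. Adding 1 to [B2] avoids a zero denominator. *)
  intros eps He. exists (Rmin rho (eps * rho / (B2 + 1))).
  assert (Hpos : 0 < eps * rho / (B2 + 1)).
  { apply Rdiv_lt_0_compat; [apply Rmult_lt_0_compat; unfold rho; lra|lra]. }
  split; [apply Rmin_glb_lt; unfold rho in *; lra|].
  intros w Hw.
  assert (Hw1 : Cmod (w - z0)%C < rho) by (eapply Rlt_le_trans; [exact Hw|apply Rmin_l]).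
  assert (Hw2 : Cmod (w - z0)%C < eps * rho / (B2 + 1))
    by (eapply Rlt_le_trans; [exact Hw|apply Rmin_r]).
  assert (Hwd : Cmod w < 1 - rho).
  { pose proof (Cmod_triangle z0 (w - z0)%C) as T.
    replace (z0 + (w - z0))%C with w in T by ring. unfold rho in *. lra. }
  assert (Hwdisc : in_disc w) by (unfold in_disc, rho in *; lra).
  rewrite (powser_factor c B z0 w) by assumption. fold c1.
  rewrite (powser_factor c1 B1 z0 w) by assumption. fold c2.
  match goal with |- Cmod ?x <= _ =>
    replace x with ((w - z0) * (w - z0) * Csum (powser c2 w))%C by ring end.
  rewrite !Cmod_mult, (Rmult_comm eps), Rmult_assoc.
  apply Rmult_le_compat_l; [apply Cmod_ge_0|].
  assert (Hb : Cmod (Csum (powser c2 w)) <= B2 / rho).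
  { eapply Rle_trans.
    - apply (powser_bound c2 B2 w); [exact HB2|exact Hwdisc|].
      apply (powser_correct c2 B2); assumption.
    - unfold Rdiv. apply Rmult_le_compat_l; [exact HB20|].
      apply Rinv_le_contravar; unfold rho in *; lra. }
  apply Rle_trans with (eps * rho / (B2 + 1) * (B2 / rho)).
  - apply Rmult_le_compat; try apply Cmod_ge_0; lra.
  - replace (eps * rho / (B2 + 1) * (B2 / rho)) with (eps * (B2 / (B2 + 1)))
      by (field; unfold rho; lra).
    rewrite <- (Rmult_1_r eps) at 2. apply Rmult_le_compat_l; [lra|].
    apply Rle_div_l; lra.
Qed.

(** * Square-summable coefficients *)

(** The l^2 norm is at most [K], expressed on partial sums so that no infinite sum has to be named;
    0 <= K lets squares be compared. *)
Definition l2le (c : nat -> C) (K : R) : Prop :=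
  0 <= K /\ forall N, sum_n (fun m => Cmod (c m) ^ 2) N <= K ^ 2.

Lemma ex_series_bounded (u : nat -> R) (K : R) :
  (forall m, 0 <= u m) -> (forall N, sum_n u N <= K) -> ex_series u.
Proof.
  intros H0 HK.
  destruct (ex_finite_lim_seq_incr (sum_n u) K) as [l Hl].
  - intros N. rewrite sum_Sn. specialize (H0 (S N)). unfold plus; simpl. lra.
  - exact HK.
  - exists l. exact Hl.
Qed.

Lemma l2le_ex_series (c : nat -> C) :
  ex_series (fun m => Cmod (c m) ^ 2) <-> exists K, l2le c K.
Proof.
  split.
  - intros [l Hl].
    assert (Hs : forall N, sum_n (fun m => Cmod (c m) ^ 2) N <= l).
    { intros N. apply sum_n_le_series; [intros m; apply pow2_ge_0|exact Hl]. }
    assert (0 <= l).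
    { eapply Rle_trans; [|apply (Hs 0%nat)]. apply sum_n_nonneg. intros; apply pow2_ge_0. }
    exists (sqrt l). split; [apply sqrt_pos|].
    intros N. rewrite pow2_sqrt by assumption. apply Hs.
  - intros [K [_ HK]]. apply ex_series_bounded with (K ^ 2); [|exact HK].
    intros m; apply pow2_ge_0.
Qed.

Lemma term_le_sum_n (u : nat -> R) (N : nat) :
  (forall m, 0 <= u m) -> u N <= sum_n u N.
Proof.
  intros H. destruct N as [|N].
  - rewrite sum_O. apply Rle_refl.
  - rewrite sum_Sn. pose proof (sum_n_nonneg u N H). unfold plus; simpl. lra.
Qed.

Lemma l2le_bounded (c : nat -> C) (K : R) :
  l2le c K -> forall m, Cmod (c m) <= K.
Proof.
  intros [HK H] m. apply Rsqr_incr_0_var; [|exact HK]. rewrite !Rsqr_pow2.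
  eapply Rle_trans; [|apply (H m)].
  apply (term_le_sum_n (fun m => Cmod (c m) ^ 2)). intros; apply pow2_ge_0.
Qed.

Lemma cauchy_schwarz_sum_n (x y : nat -> R) (X Y : R) (N : nat) :
  0 <= X -> 0 <= Y ->
  sum_n (fun m => x m ^ 2) N <= X ^ 2 -> sum_n (fun m => y m ^ 2) N <= Y ^ 2 ->
  sum_n (fun m => x m * y m) N <= X * Y.
Proof.
  intros HX HY Hx Hy.
  assert (H : (sum_n (fun m => x m * y m) N) ^ 2 <=
     sum_n (fun m => x m ^ 2) N * sum_n (fun m => y m ^ 2) N).
  { clear. induction N as [|N IH].
    - rewrite !sum_O. nra.
    - rewrite !sum_Sn. unfold plus; simpl.
      pose proof (sum_n_nonneg (fun m => x m ^ 2) N (fun m => pow2_ge_0 _)) as HA.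
      pose proof (sum_n_nonneg (fun m => y m ^ 2) N (fun m => pow2_ge_0 _)) as HB.
      simpl in IH, HA, HB.
      set (A := sum_n (fun m => x m * (x m * 1)) N) in *.
      set (B := sum_n (fun m => y m * (y m * 1)) N) in *.
      set (S0 := sum_n (fun m => x m * y m) N) in *.
      generalize (x (S N)) (y (S N)). intros u v.
      (* The cross term is controlled by S0^2 <= A B and the arithmetic-geometric mean inequality
         for A v^2 and B u^2. *)
      assert (Hk : 2 * S0 * (u * v) <= A * v ^ 2 + B * u ^ 2).
      { apply Rsqr_incr_0_var; [|nra].
        unfold Rsqr.
        assert (0 <= (A * v ^ 2 - B * u ^ 2) ^ 2) by apply pow2_ge_0.
        assert (S0 * S0 * (u * v) ^ 2 <= A * B * (u * v) ^ 2).
        { apply Rmult_le_compat_r; [apply pow2_ge_0|nra]. }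
        nra. }
      nra. }
  pose proof (sum_n_nonneg (fun m => x m ^ 2) N (fun m => pow2_ge_0 _)) as HA.
  pose proof (sum_n_nonneg (fun m => y m ^ 2) N (fun m => pow2_ge_0 _)) as HB.
  apply Rsqr_incr_0_var; [|apply Rmult_le_pos; assumption].
  unfold Rsqr.
  assert (sum_n (fun m => x m ^ 2) N * sum_n (fun m => y m ^ 2) N <= X ^ 2 * Y ^ 2)
    by (apply Rmult_le_compat; assumption).
  nra.
Qed.

Lemma sum_n_Rmult (k : R) (u : nat -> R) (N : nat) :
  sum_n (fun m => k * u m) N = k * sum_n u N.
Proof. exact (sum_n_mult_l (K := R_Ring) k u N). Qed.

Lemma sum_n_Rplus (u v : nat -> R) (N : nat) :
  sum_n (fun m => u m + v m) N = sum_n u N + sum_n v N.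
Proof. exact (sum_n_plus (G := R_AbelianMonoid) u v N). Qed.

(** Minkowski's inequality: Cauchy-Schwarz bounds the cross terms and completes the square (K +
    L)^2. *)
Lemma l2le_plus (c d : nat -> C) (K L : R) :
  l2le c K -> l2le d L -> l2le (fun m => (c m + d m)%C) (K + L).
Proof.
  intros [HK Hc] [HL Hd]. split; [lra|]. intros N.
  assert (Hcs := cauchy_schwarz_sum_n (fun m => Cmod (c m)) (fun m => Cmod (d m))
    K L N HK HL (Hc N) (Hd N)).
  apply Rle_trans with
    (sum_n (fun m => (Cmod (c m) ^ 2 + Cmod (d m) ^ 2)
                     + 2 * (Cmod (c m) * Cmod (d m))) N).
  - apply sum_n_m_le. intros m.
    pose proof (Cmod_triangle (c m) (d m)). pose proof (Cmod_ge_0 (c m + d m)%C).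
    pose proof (Cmod_ge_0 (c m)). pose proof (Cmod_ge_0 (d m)). nra.
  - rewrite !sum_n_Rplus, sum_n_Rmult. specialize (Hc N). specialize (Hd N). nra.
Qed.

Lemma l2le_scal (k : R) (c : nat -> C) (K : R) :
  l2le c K -> l2le (fun m => (k * c m)%C) (Rabs k * K).
Proof.
  intros [HK Hc]. split; [apply Rmult_le_pos; [apply Rabs_pos|exact HK]|].
  intros N.
  rewrite (sum_n_ext _ (fun m => k ^ 2 * Cmod (c m) ^ 2)).
  - rewrite sum_n_Rmult. rewrite Rpow_mult_distr, pow2_abs.
    apply Rmult_le_compat_l; [apply pow2_ge_0|apply Hc].
  - intros m. rewrite Cmod_mult, Cmod_R, Rpow_mult_distr, pow2_abs. reflexivity.
Qed.

Lemma l2le_weaken (c : nat -> C) (K L : R) : K <= L -> l2le c K -> l2le c L.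
Proof.
  intros HKL [HK H]. split; [lra|]. intros N.
  eapply Rle_trans; [apply H|]. apply pow_incr. lra.
Qed.

Lemma l2le_ext (c d : nat -> C) (K : R) : (forall m, c m = d m) -> l2le c K -> l2le d K.
Proof.
  intros E [HK H]. split; [exact HK|]. intros N.
  rewrite <- (sum_n_ext (fun m => Cmod (c m) ^ 2)); [apply H|].
  intros m. rewrite E. reflexivity.
Qed.

(** A form of Fatou's lemma: each partial sum involves finitely many coordinates, so coordinatewise
    convergence is enough to keep the norm bound. *)
Lemma l2le_lim (u : nat -> nat -> C) (c : nat -> C) (K : R) :
  (forall j, l2le (u j) K) ->
  (forall m, is_lim_seq (fun j => Cmod (u j m - c m)%C) 0) ->
  l2le c K.
Proof.
  intros Hu Hl. split; [apply (Hu 0%nat)|]. intros N.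
  assert (Hm : forall m, is_lim_seq (fun j => Cmod (u j m)) (Cmod (c m))).
  { intros m. apply is_lim_seq_le_le with
      (fun j => Cmod (c m) - Cmod (u j m - c m)%C)
      (fun j => Cmod (c m) + Cmod (u j m - c m)%C).
    - intros j. split.
      + pose proof (Cmod_triangle_sub (u j m) (u j m - c m)%C) as T.
        replace (u j m - (u j m - c m))%C with (c m) in T by ring. lra.
      + pose proof (Cmod_triangle (c m) (u j m - c m)%C) as T.
        replace (c m + (u j m - c m))%C with (u j m) in T by ring. lra.
    - replace (Finite (Cmod (c m))) with (Finite (Cmod (c m) - 0)) by (f_equal; ring).
      apply is_lim_seq_minus'; [apply is_lim_seq_const|apply Hl].
    - replace (Finite (Cmod (c m))) with (Finite (Cmod (c m) + 0)) by (f_equal; ring).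
      apply is_lim_seq_plus'; [apply is_lim_seq_const|apply Hl]. }
  assert (Hs : is_lim_seq (fun j => sum_n (fun m => Cmod (u j m) ^ 2) N)
                 (sum_n (fun m => Cmod (c m) ^ 2) N)).
  { assert (Hm2 : forall m, is_lim_seq (fun j => Cmod (u j m) ^ 2) (Cmod (c m) ^ 2)).
    { intros m. simpl. apply is_lim_seq_mult'; [apply Hm|].
      apply is_lim_seq_mult'; [apply Hm|apply is_lim_seq_const]. }
    induction N as [|N IH].
    - rewrite sum_O. apply is_lim_seq_ext with (2 := Hm2 0%nat).
      intros j. rewrite sum_O. reflexivity.
    - rewrite sum_Sn.
      apply is_lim_seq_ext with (2 := is_lim_seq_plus' _ _ _ _ IH (Hm2 (S N))).
      intros j. rewrite sum_Sn. reflexivity. }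
  apply (is_lim_seq_le _ (fun _ => K ^ 2) _ _ (fun j => proj2 (Hu j) N) Hs
    (is_lim_seq_const _)).
Qed.

(** Cauchy-Schwarz against the powers of |z|; 1 / sqrt (1 - |z|^2) is the norm of the Szego kernel
    at z. *)
Lemma l2le_eval (c : nat -> C) (K : R) (z l : C) :
  l2le c K -> in_disc z -> is_series (powser c z) l ->
  Cmod l <= K / sqrt (1 - Cmod z ^ 2).
Proof.
  intros [HK H] Hz Hl. apply (Cseries_norm_le _ _ _ Hl). intros N.
  eapply Rle_trans; [apply Cmod_sum_n_le|].
  rewrite (sum_n_ext _ (fun m => Cmod (c m) * Cmod z ^ m)).
  2:{ intros m. unfold powser. rewrite Cmod_mult, Cmod_pown. reflexivity. }
  assert (Hq : 0 <= Cmod z ^ 2 < 1).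
  { pose proof (Cmod_ge_0 z). unfold in_disc in Hz. nra. }
  apply cauchy_schwarz_sum_n with (3 := H N).
  - exact HK.
  - apply Rlt_le, Rinv_0_lt_compat, sqrt_lt_R0. lra.
  - rewrite pow_inv, pow2_sqrt by lra.
    rewrite (sum_n_ext _ (fun m => (Cmod z ^ 2) ^ m)).
    2:{ intros m. rewrite <- !pow_mult. f_equal. lia. }
    apply sum_n_le_series.
    + intros m. apply pow_le. lra.
    + apply is_series_geom. rewrite Rabs_pos_eq; lra.
Qed.

(** * The truncated space is the Hardy space as a set *)

Definition in_H2 (g : C -> C) : Prop :=
  exists c K, l2le c K /\ forall z, in_disc z -> is_series (powser c z) (g z).

Lemma is_Cseries_eventually (a b : nat -> C) (n : nat) (l : C) :
  (forall N, (n <= N)%nat -> sum_n a N = sum_n b N) -> is_series a l -> is_series b l.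
Proof.
  intros E H. apply is_Cseries_eps. intros eps He.
  destruct (proj1 (is_Cseries_eps a l) H eps He) as [N HN].
  exists (max n N). intros k Hk. rewrite <- E by lia. apply HN. lia.
Qed.

(** Each f_m spills b_m z^(m+1) into the next degree. Partial sums therefore agree up to the single
    spill of the last term, which vanishes once b_N = 0. *)
Lemma sum_n_fbasis (b a c : nat -> C) (z : C) (N : nat) :
  a 0%nat = c 0%nat -> (forall m, a (S m) = (c (S m) + b m * c m)%C) ->
  (sum_n (powser a z) N + b N * c N * Cpown z (S N))%C =
  sum_n (fun m => (c m * fbasis b m z)%C) N.
Proof.
  intros H0 HS. induction N as [|N IH].
  - rewrite !sum_O. unfold powser, fbasis. rewrite H0. simpl. Cring.
  - rewrite !sum_Sn, <- IH. unfold powser at 2, fbasis, plus. rewrite HS. simpl. Cring.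
Qed.

Lemma series_fbasis (n : nat) (b a c : nat -> C) (z l : C) :
  (forall t, (n <= t)%nat -> b t = 0%C) ->
  a 0%nat = c 0%nat -> (forall m, a (S m) = (c (S m) + b m * c m)%C) ->
  is_series (powser a z) l <-> is_series (fun m => (c m * fbasis b m z)%C) l.
Proof.
  intros hb H0 HS.
  assert (E : forall N, (n <= N)%nat ->
    sum_n (powser a z) N = sum_n (fun m => (c m * fbasis b m z)%C) N).
  { intros N HN. rewrite <- (sum_n_fbasis b a c z N H0 HS), (hb N HN).
    set (s := sum_n (powser a z) N : C). Cring. }
  split; apply is_Cseries_eventually with n; [exact E|].
  intros N HN. symmetry. exact (E N HN).
Qed.

Lemma ex_series_Cmod2_eventually (n : nat) (b a c : nat -> C) :
  (forall t, (n <= t)%nat -> b t = 0%C) ->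
  (forall m, a (S m) = (c (S m) + b m * c m)%C) ->
  ex_series (fun m => Cmod (a m) ^ 2) <-> ex_series (fun m => Cmod (c m) ^ 2).
Proof.
  intros hb HS.
  rewrite (ex_series_incr_n (fun m => Cmod (a m) ^ 2) (S n)).
  rewrite (ex_series_incr_n (fun m => Cmod (c m) ^ 2) (S n)).
  assert (E : forall m, a (S n + m)%nat = c (S n + m)%nat).
  { intros m. simpl. rewrite HS, hb by lia. Cring. }
  split; apply ex_series_ext; intros m; rewrite E; reflexivity.
Qed.

(** Inverts the change a_(k+1) = c_(k+1) + b_k c_k by forward substitution. *)
Fixpoint fbasis_coef (b a : nat -> C) (m : nat) : C :=
  match m with
  | O => a O
  | S k => (a (S k) - b k * fbasis_coef b a k)%C
  end.

Lemma in_trunc_space_H2 (n : nat) (b : nat -> C) (g : C -> C) :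
  (forall t, (n <= t)%nat -> b t = 0%C) -> in_trunc_space b g <-> in_H2 g.
Proof.
  intros hb. split.
  - intros [c [Hc Hs]].
    set (a := fun m => match m with O => c O | S k => (c (S k) + b k * c k)%C end).
    assert (HS : forall m, a (S m) = (c (S m) + b m * c m)%C) by reflexivity.
    apply (ex_series_Cmod2_eventually n b a c hb HS) in Hc.
    apply l2le_ex_series in Hc. destruct Hc as [K HK].
    exists a, K. split; [exact HK|]. intros z Hz.
    apply (series_fbasis n b a c z (g z) hb eq_refl HS). apply Hs. exact Hz.
  - intros [a [K [HK Hs]]].
    set (c := fbasis_coef b a).
    assert (HS : forall m, a (S m) = (c (S m) + b m * c m)%C).
    { intros m. unfold c. simpl. ring. }
    exists c. split.
    + apply (ex_series_Cmod2_eventually n b a c hb HS). apply l2le_ex_series.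
      exists K. exact HK.
    + intros z Hz. apply (series_fbasis n b a c z (g z) hb eq_refl HS). apply Hs. exact Hz.
Qed.

(** * Multipliers of the Hardy space are bounded *)

(** The sum exists by boundedness of the coefficients; splitting off the first term gives l = 1 + q
    l, and uniqueness of the sum determines l. *)
Lemma Cgeom (q : C) : in_disc q -> is_series (powser (fun _ => 1%C) q) (/ (1 - q))%C.
Proof.
  intros Hq.
  assert (H : is_series (powser (fun _ => 1%C) q) (Csum (powser (fun _ => 1%C) q))).
  { apply (powser_correct _ 1); [intros m; rewrite Cmod_1; lra|exact Hq]. }
  assert (E := Cseries_unique _ _ _ H (powser_cons (fun _ => 1%C) q _ H)).
  set (l := Csum (powser (fun _ => 1%C) q)) in *.
  assert (Hq1 : (1 - q)%C <> 0%C).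
  { intros h. assert (q = 1%C) as ->.
    { replace q with (1 - (1 - q))%C by ring. rewrite h. ring. }
    unfold in_disc in Hq. rewrite Cmod_1 in Hq. lra. }
  replace (/ (1 - q))%C with l; [exact H|].
  assert (E2 : (l * (1 - q) = 1)%C).
  { replace (l * (1 - q))%C with (l - q * l)%C by ring. rewrite E at 1. ring. }
  replace l with (l * (1 - q) / (1 - q))%C by (field; exact Hq1).
  rewrite E2. field. exact Hq1.
Qed.

(** The reciprocal of the norm of the Szego kernel k_w(z) = 1 / (1 - conj(w) z). *)
Definition kernel_gap (w : C) : R := sqrt (1 - Cmod w ^ 2).

(** The Taylor coefficients of the normalised Szego kernel k_w / ||k_w||. *)
Definition unit_kernel (w : C) (m : nat) : C := (kernel_gap w * Cpown (Cconj w) m)%C.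

Lemma kernel_gap_pos (w : C) : in_disc w -> 0 < kernel_gap w.
Proof.
  intros Hw. apply sqrt_lt_R0. unfold in_disc in Hw. pose proof (Cmod_ge_0 w). nra.
Qed.

Lemma unit_kernel_l2le (w : C) : in_disc w -> l2le (unit_kernel w) 1.
Proof.
  intros Hw. split; [lra|]. intros N.
  assert (Hq : 0 <= Cmod w ^ 2 < 1).
  { pose proof (Cmod_ge_0 w). unfold in_disc in Hw. nra. }
  rewrite (sum_n_ext _ (fun m => (1 - Cmod w ^ 2) * (Cmod w ^ 2) ^ m)).
  2:{ intros m. unfold unit_kernel.
      rewrite Cmod_mult, Cmod_R, Cmod_pown, Cmod_conj, Rpow_mult_distr, pow2_abs.
      unfold kernel_gap. rewrite pow2_sqrt by lra. f_equal.
      rewrite <- !pow_mult. f_equal. lia. }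
  rewrite sum_n_Rmult.
  apply Rle_trans with ((1 - Cmod w ^ 2) * / (1 - Cmod w ^ 2)).
  - apply Rmult_le_compat_l; [lra|]. apply sum_n_le_series.
    + intros m. apply pow_le. lra.
    + apply is_series_geom. rewrite Rabs_pos_eq; lra.
  - rewrite Rinv_r; lra.
Qed.

(** The normalised kernel attains the bound of [l2le_eval] with K = 1 at its own point, which makes
    it the right hump there. *)
Lemma unit_kernel_eval (w : C) :
  in_disc w -> is_series (powser (unit_kernel w) w) (RtoC (/ kernel_gap w)).
Proof.
  intros Hw. pose proof (kernel_gap_pos w Hw) as Hs.
  assert (Hq : 0 <= Cmod w ^ 2 < 1).
  { pose proof (Cmod_ge_0 w). unfold in_disc in Hw. nra. }
  assert (Hd : in_disc (RtoC (Cmod w ^ 2))).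
  { unfold in_disc. rewrite Cmod_R, Rabs_pos_eq; lra. }
  assert (E : RtoC (/ kernel_gap w) = (kernel_gap w * / (1 - RtoC (Cmod w ^ 2)))%C).
  { rewrite <- RtoC_minus, <- RtoC_inv, <- RtoC_mult by lra. f_equal.
    replace (1 - Cmod w ^ 2) with (kernel_gap w ^ 2); [field; lra|].
    unfold kernel_gap. apply pow2_sqrt. lra. }
  rewrite E.
  apply is_series_ext with (2 := Cseries_scal (kernel_gap w) _ _ (Cgeom _ Hd)).
  intros m. unfold powser, unit_kernel. rewrite Cmod2_conj.
  assert (P : forall k, Cpown (w * Cconj w)%C k = (Cpown (Cconj w) k * Cpown w k)%C).
  { induction k as [|k IH]; simpl; [ring|]. rewrite IH. ring. }
  rewrite P. Cring.
Qed.

Lemma one_in_H2 : in_H2 (fun _ => 1%C).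
Proof.
  set (c := fun m : nat => match m return C with O => RtoC 1 | _ => RtoC 0 end).
  exists c, 1.
  assert (Hs : forall N, sum_n (fun m => Cmod (c m) ^ 2) N = 1).
  { induction N as [|N IH].
    - rewrite sum_O. simpl c. rewrite Cmod_1. apply pow1.
    - rewrite sum_Sn, IH. simpl c. rewrite Cmod_0. unfold plus; simpl. ring. }
  split.
  - split; [lra|]. intros N. rewrite Hs. lra.
  - intros z _. apply is_Cseries_eps. intros eps He. exists 0%nat. intros N _.
    replace (sum_n _ N) with (RtoC 1).
    + replace (1 - 1)%C with (RtoC 0) by ring. rewrite Cmod_0. exact He.
    + induction N as [|N IH].
      * rewrite sum_O. unfold powser. simpl. Cring.
      * rewrite sum_Sn, <- IH. unfold powser, plus. simpl. Cring.
Qed.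

Section GlidingHump.

(* Sokal's proof of the uniform boundedness principle, for the functionals
   [f |-> phi (w j) * f (w j) * kernel_gap (w j)] of norm [|phi (w j)|]. *)

Variable w : nat -> C.
Hypothesis w_disc : forall j, in_disc (w j).

(** With u the value of [x] at [w j] and v that of the new term, u + v and u - v differ by 2 v, so
    one of them has modulus at least v; the sign selects such a one. The multiplier is absent, since
    it scales both candidates equally. *)
Definition hump_sign (j : nat) (x : nat -> C) : R :=
  if Rle_dec (/ 3 ^ j / kernel_gap (w j))
       (Cmod (Csum (powser x (w j)) + RtoC (/ 3 ^ j / kernel_gap (w j)))%C)
  then 1 else -1.

(** [hump j] collects the terms of index below j, so the value at [w j] is tested on
    [hump (S j)]. *)
Fixpoint hump (j : nat) : nat -> C :=
  match j with
  | O => fun _ => 0%C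
  | S k => fun m =>
      (hump k m + RtoC (hump_sign k (hump k) * / 3 ^ k) * unit_kernel (w k) m)%C
  end.

Lemma hump_sign_abs (j : nat) (x : nat -> C) : Rabs (hump_sign j x) = 1.
Proof.
  unfold hump_sign. destruct Rle_dec.
  - apply Rabs_R1.
  - rewrite Rabs_left; lra.
Qed.

Lemma inv_pow3_pos (j : nat) : 0 < / 3 ^ j.
Proof. apply Rinv_0_lt_compat, pow_lt. lra. Qed.

Lemma inv_pow3_S (j : nat) : / 3 ^ S j = / 3 ^ j / 3.
Proof. simpl. rewrite Rinv_mult. field. apply pow_nonzero. lra. Qed.

Lemma hump_step_l2le (j : nat) :
  l2le (fun m => (hump (S j) m - hump j m)%C) (/ 3 ^ j).
Proof.
  apply l2le_ext with
    (fun m => (RtoC (hump_sign j (hump j) * / 3 ^ j) * unit_kernel (w j) m)%C).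
  - intros m. simpl. ring.
  - apply l2le_weaken with (Rabs (hump_sign j (hump j) * / 3 ^ j) * 1).
    + rewrite Rabs_mult, hump_sign_abs, Rabs_pos_eq; [lra|].
      apply Rlt_le, inv_pow3_pos.
    + apply l2le_scal, unit_kernel_l2le, w_disc.
Qed.

(** The constant is the exact geometric sum of 3^-l for i <= l < k + i; keeping the subtracted term
    lets the induction close. *)
Lemma hump_diff_l2le (i k : nat) :
  l2le (fun m => (hump (k + i) m - hump i m)%C) (3 / 2 * (/ 3 ^ i - / 3 ^ (k + i))).
Proof.
  induction k as [|k IH].
  - split; [simpl; lra|]. intros N. simpl (0 + i)%nat.
    rewrite (sum_n_ext _ (fun _ => 0 * 0)).
    + rewrite sum_n_Rmult. nra.
    + intros m. replace (hump i m - hump i m)%C with (RtoC 0) by ring.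
      rewrite Cmod_0. change (0 ^ 2 = 0 * 0). ring.
  - change (S k + i)%nat with (S (k + i)).
    apply l2le_ext with (fun m =>
      ((hump (k + i) m - hump i m) + (hump (S (k + i)) m - hump (k + i) m))%C).
    + intros m. ring.
    + apply l2le_weaken with (2 := l2le_plus _ _ _ _ IH (hump_step_l2le (k + i))).
      rewrite inv_pow3_S. lra.
Qed.

Lemma hump_eval (j : nat) :
  / 3 ^ j / kernel_gap (w j) <= Cmod (Csum (powser (hump (S j)) (w j))).
Proof.
  assert (Hj : exists K, l2le (hump j) K).
  { exists (3 / 2 * (/ 3 ^ 0 - / 3 ^ (j + 0))).
    apply l2le_ext with (2 := hump_diff_l2le 0 j). intros m.
    replace (j + 0)%nat with j by lia. simpl. ring. }
  destruct Hj as [K HK].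
  set (v := / 3 ^ j / kernel_gap (w j)).
  assert (Hv : 0 < v).
  { apply Rdiv_lt_0_compat; [apply inv_pow3_pos|apply kernel_gap_pos, w_disc]. }
  set (u := Csum (powser (hump j) (w j))).
  replace (Csum (powser (hump (S j)) (w j)))
    with (u + RtoC (hump_sign j (hump j)) * RtoC v)%C.
  2:{ symmetry. apply Csum_eq. unfold v, Rdiv. rewrite RtoC_mult, Cmult_assoc, <- RtoC_mult.
      apply is_series_ext with (2 := Cseries_plus _ _ _ _
        (powser_correct (hump j) K (w j) (l2le_bounded _ _ HK) (w_disc j))
        (Cseries_scal (RtoC (hump_sign j (hump j) * / 3 ^ j)) _ _
          (unit_kernel_eval (w j) (w_disc j)))).
      intros m. unfold powser. simpl. Cring. }
  unfold hump_sign. fold v u. destruct Rle_dec as [h|h].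
  - rewrite Cmult_1_l. exact h.
  - apply Rnot_le_lt in h.
    pose proof (Cmod_triangle_sub (u + RtoC v)%C (u + RtoC (-1) * RtoC v)%C) as T.
    replace (u + RtoC v - (u + RtoC (-1) * RtoC v))%C with (RtoC (2 * v)) in T.
    + rewrite Cmod_R, Rabs_pos_eq in T; lra.
    + rewrite RtoC_mult. ring.
Qed.

(** After [hump (S j)] the remainder has norm at most 3/2 * 3^-(j+1), that is 3^-j / 2, so passing
    to the limit destroys at most half of the value that [hump_eval] guarantees at [w j]. *)
Lemma hump_limit : exists x : nat -> C,
  (exists K, l2le x K) /\
  forall j, / 3 ^ j / 2 / kernel_gap (w j) <= Cmod (Csum (powser x (w j))).
Proof.
  (* The limit is taken coordinate by coordinate, and [l2le_lim] then carries the norm bounds over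
     to it. *)
  assert (Hlim : forall m, exists l : C, is_lim_seq (fun j => Cmod (hump j m - l)%C) 0).
  { intros m.
    assert (Hex : ex_series (V := C_NormedModule) (fun j => (hump (S j) m - hump j m)%C)).
    { apply (ex_series_le (V := C_CompleteNormedModule) _ (fun j => (/ 3) ^ j)).
      - intros j. change (Cmod (hump (S j) m - hump j m)%C <= (/ 3) ^ j).
        rewrite pow_inv. apply (l2le_bounded _ _ (hump_step_l2le j) m).
      - exists (/ (1 - / 3)). apply is_series_geom. rewrite Rabs_pos_eq; lra. }
    destruct Hex as [l Hl]. exists l.
    apply is_lim_seq_incr_1. apply is_lim_seq_spec. intros eps.
    destruct (proj1 (is_Cseries_eps _ l) Hl eps (cond_pos eps)) as [N HN].
    exists N. intros j Hj. rewrite Rminus_0_r, Rabs_pos_eq by apply Cmod_ge_0.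
    (* The series of increments telescopes from [hump 0], which is zero. *)
    replace (hump (S j) m) with (sum_n (fun j => (hump (S j) m - hump j m)%C) j : C);
      [apply HN, Hj|].
    clear. induction j as [|j IH].
    - rewrite sum_O. simpl. ring.
    - rewrite sum_Sn, IH. change plus with Cplus. ring. }
  destruct (choice_fun _ _ _ Hlim) as [x Hx]. exists x.
  assert (Hdiff : forall i, l2le (fun m => (x m - hump i m)%C) (3 / 2 * / 3 ^ i)).
  { intros i. apply l2le_lim with (fun k m => (hump (k + i) m - hump i m)%C).
    - intros k. apply l2le_weaken with (2 := hump_diff_l2le i k).
      pose proof (inv_pow3_pos (k + i)). lra.
    - intros m. apply is_lim_seq_ext with (fun k => Cmod (hump (k + i) m - x m)%C).
      + intros k. f_equal. ring.
      + apply (is_lim_seq_incr_n (fun j => Cmod (hump j m - x m)%C) i). apply Hx. }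
  assert (HxK : l2le x (3 / 2 * / 3 ^ 0)).
  { apply l2le_ext with (2 := Hdiff 0%nat). intros m. simpl. ring. }
  split; [exists (3 / 2 * / 3 ^ 0); exact HxK|].
  intros j. pose proof (hump_eval j) as He.
  pose proof (kernel_gap_pos (w j) (w_disc j)) as Hg.
  set (h := Csum (powser (hump (S j)) (w j))) in *.
  assert (Hxs := powser_correct x _ (w j) (l2le_bounded _ _ HxK) (w_disc j)).
  set (X := Csum (powser x (w j))) in *.
  assert (Hh : exists K, forall m, Cmod (hump (S j) m) <= K).
  { exists (3 / 2 * / 3 ^ 0 + 3 / 2 * / 3 ^ S j). intros m.
    replace (hump (S j) m) with (x m - (x m - hump (S j) m))%C by ring.
    eapply Rle_trans; [apply Cmod_triangle_sub|].
    apply Rplus_le_compat; [apply (l2le_bounded _ _ HxK)|].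
    apply (l2le_bounded _ _ (Hdiff (S j)) m). }
  destruct Hh as [K HK].
  assert (Hhs := powser_correct _ K (w j) HK (w_disc j)). fold h in Hhs.
  assert (Hd : Cmod (X - h)%C <= 3 / 2 * / 3 ^ S j / kernel_gap (w j)).
  { apply (l2le_eval _ _ (w j) _ (Hdiff (S j)) (w_disc j)).
    apply is_series_ext with (2 := Cseries_minus _ _ _ _ Hxs Hhs).
    intros m. unfold powser. Cring. }
  rewrite inv_pow3_S in Hd.
  replace (3 / 2 * (/ 3 ^ j / 3) / kernel_gap (w j))
    with (/ 3 ^ j / 2 / kernel_gap (w j)) in Hd
    by (field; repeat split; try apply pow_nonzero; lra).
  pose proof (Cmod_triangle_sub X (X - h)%C) as T.
  replace (X - (X - h))%C with h in T by ring.
  replace (/ 3 ^ j / kernel_gap (w j)) with (2 * (/ 3 ^ j / 2 / kernel_gap (w j))) in He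
    by (field; repeat split; try apply pow_nonzero; lra).
  lra.
Qed.

End GlidingHump.

Lemma H2_multiplier_Hinfty (phi : C -> C) :
  (forall g, in_H2 g -> in_H2 (fun z => (phi z * g z)%C)) -> in_Hinfty phi.
Proof.
  intros Hm. split.
  - intros z Hz. destruct (Hm _ one_in_H2) as [a [K [HK Hs]]].
    destruct (cderiv_powser a K z (l2le_bounded _ _ HK) Hz) as [l Hl].
    exists l. apply cderiv_is_derive.
    apply cderiv_ext_disc with (3 := Hl); [exact Hz|].
    intros v Hv. rewrite (Csum_eq _ _ (Hs v Hv)). ring.
  - destruct (classic (exists M, forall z, in_disc z -> Cmod (phi z) <= M)) as [h|h];
      [exact h|exfalso].
    (* If [phi] is unbounded, its values can be chosen to outgrow the weights 3^j of the humps. *)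
    assert (Hw : forall j : nat, exists w, in_disc w /\ 4 ^ j <= Cmod (phi w)).
    { intros j. apply NNPP. intros H. apply h. exists (4 ^ j). intros z Hz.
      apply Rnot_lt_le. intros Hlt. apply H. exists z. split; [exact Hz|lra]. }
    destruct (choice_fun _ _ _ Hw) as [w Hw'].
    destruct (hump_limit w (fun j => proj1 (Hw' j))) as [x [[K HK] Hx]].
    destruct (Hm (fun z => Csum (powser x z))) as [d [L [HL Hd]]].
    { exists x, K. split; [exact HK|]. intros z Hz.
      apply (powser_correct x K); [apply l2le_bounded, HK|exact Hz]. }
    (* At [w j] the lower bound from the hump and the upper bound from [l2le_eval] for the product
       share the factor 1 / [kernel_gap (w j)], which cancels. *)
    assert (Hbad : forall j, (4 / 3) ^ j <= 2 * L).
    { intros j. destruct (Hw' j) as [Hj Hj4].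
      pose proof (l2le_eval d L (w j) _ HL Hj (Hd (w j) Hj)) as He.
      fold (kernel_gap (w j)) in He. rewrite Cmod_mult in He.
      pose proof (kernel_gap_pos (w j) Hj) as Hg. specialize (Hx j).
      pose proof (inv_pow3_pos j) as H3.
      assert (Hp : 0 < 4 ^ j) by (apply pow_lt; lra).
      assert (H1 : 4 ^ j * (/ 3 ^ j / 2 / kernel_gap (w j)) <= L / kernel_gap (w j)).
      { eapply Rle_trans; [|exact He]. apply Rmult_le_compat; [lra| |exact Hj4|exact Hx].
        apply Rlt_le. repeat apply Rdiv_lt_0_compat; lra. }
      apply Rmult_le_compat_r with (r := kernel_gap (w j)) in H1; [|lra].
      replace (L / kernel_gap (w j) * kernel_gap (w j)) with L in H1 by (field; lra).
      unfold Rdiv. rewrite Rpow_mult_distr, pow_inv.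
      replace (4 ^ j * (/ 3 ^ j / 2 / kernel_gap (w j)) * kernel_gap (w j))
        with (4 ^ j * / 3 ^ j / 2) in H1 by (field; repeat split; try apply pow_nonzero; lra).
      lra. }
    destruct (Pow_x_infinity (4 / 3)) with (b := 2 * L + 1) as [N HN].
    { rewrite Rabs_pos_eq; lra. }
    specialize (HN N (le_n N)). specialize (Hbad N).
    rewrite Rabs_pos_eq in HN; [lra|]. apply pow_le. lra.
Qed.

(** * Integrals of complex-valued functions of a real variable *)

Definition ccont_at (f : R -> C) (t : R) : Prop :=
  forall eps, 0 < eps -> exists delta, 0 < delta /\
    forall u, Rabs (u - t) < delta -> Cmod (f u - f t)%C < eps.

Definition cint (f : R -> C) (a b : R) : C :=
  (RInt (fun t => fst (f t)) a b, RInt (fun t => snd (f t)) a b).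

Definition ex_cint (f : R -> C) (a b : R) : Prop :=
  ex_RInt (fun t => fst (f t)) a b /\ ex_RInt (fun t => snd (f t)) a b.

Lemma fst_le_Cmod (z : C) : Rabs (fst z) <= Cmod z.
Proof. eapply Rle_trans; [apply Rmax_l|apply Rmax_Cmod]. Qed.

Lemma snd_le_Cmod (z : C) : Rabs (snd z) <= Cmod z.
Proof. eapply Rle_trans; [apply Rmax_r|apply Rmax_Cmod]. Qed.

Lemma continuous_eps (f : R -> R) (t : R) :
  (forall eps, 0 < eps -> exists delta, 0 < delta /\
     forall u, Rabs (u - t) < delta -> Rabs (f u - f t) < eps) ->
  continuous f t.
Proof.
  intros H. apply (proj2 (filterlim_locally f (f t))). intros eps.
  destruct (H eps (cond_pos eps)) as [d [Hd H']].
  exists (mkposreal d Hd). intros u Hu. apply H'. exact Hu.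
Qed.

Lemma ccont_at_fst (f : R -> C) (t : R) :
  ccont_at f t -> continuous (fun u => fst (f u)) t.
Proof.
  intros H. apply continuous_eps. intros eps He. destruct (H eps He) as [d [Hd H']].
  exists d. split; [exact Hd|]. intros u Hu.
  eapply Rle_lt_trans; [|apply (H' u Hu)]. apply (fst_le_Cmod (f u - f t)%C).
Qed.

Lemma ccont_at_snd (f : R -> C) (t : R) :
  ccont_at f t -> continuous (fun u => snd (f u)) t.
Proof.
  intros H. apply continuous_eps. intros eps He. destruct (H eps He) as [d [Hd H']].
  exists d. split; [exact Hd|]. intros u Hu.
  eapply Rle_lt_trans; [|apply (H' u Hu)]. apply (snd_le_Cmod (f u - f t)%C).
Qed.

Lemma ex_cint_cont (f : R -> C) (a b : R) :
  a <= b -> (forall t, a <= t <= b -> ccont_at f t) -> ex_cint f a b.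
Proof.
  intros Hab H. split; apply (ex_RInt_continuous (V := R_CompleteNormedModule));
    intros t Ht; rewrite Rmin_left, Rmax_right in Ht by exact Hab.
  - apply ccont_at_fst, H, Ht.
  - apply ccont_at_snd, H, Ht.
Qed.

Lemma C_ext (x y : C) : fst x = fst y -> snd x = snd y -> x = y.
Proof. destruct x, y; simpl; intros -> ->; reflexivity. Qed.

Lemma is_RInt_lincomb (f g : R -> R) (a b p q : R) :
  ex_RInt f a b -> ex_RInt g a b ->
  is_RInt (fun t => p * f t + q * g t) a b (p * RInt f a b + q * RInt g a b).
Proof.
  intros Hf Hg.
  apply (is_RInt_plus (V := R_NormedModule) (fun t => scal p (f t)) (fun t => scal q (g t)));
    apply (is_RInt_scal (V := R_NormedModule));
    apply (RInt_correct (V := R_CompleteNormedModule)); assumption.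
Qed.

Lemma cint_plus (f g : R -> C) (a b : R) :
  ex_cint f a b -> ex_cint g a b ->
  ex_cint (fun t => (f t + g t)%C) a b /\
  cint (fun t => (f t + g t)%C) a b = (cint f a b + cint g a b)%C.
Proof.
  intros [F1 F2] [G1 G2]. split.
  - split; apply (ex_RInt_plus (V := R_NormedModule)); assumption.
  - apply C_ext; simpl; apply (RInt_plus (V := R_CompleteNormedModule)); assumption.
Qed.

Lemma cint_scal (k : C) (f : R -> C) (a b : R) :
  ex_cint f a b ->
  ex_cint (fun t => (k * f t)%C) a b /\
  cint (fun t => (k * f t)%C) a b = (k * cint f a b)%C.
Proof.
  intros [F1 F2].
  pose proof (is_RInt_lincomb _ _ a b (fst k) (- snd k) F1 F2) as H1.
  pose proof (is_RInt_lincomb _ _ a b (fst k) (snd k) F2 F1) as H2.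
  apply (is_RInt_ext _ (fun t => fst (k * f t)%C)) in H1.
  2:{ intros t _. simpl. change (fst k * fst (f t) + - snd k * snd (f t) =
        fst k * fst (f t) - snd k * snd (f t)). ring. }
  apply (is_RInt_ext _ (fun t => snd (k * f t)%C)) in H2.
  2:{ intros t _. reflexivity. }
  split.
  - split; eexists; [exact H1|exact H2].
  - apply C_ext.
    + etransitivity; [exact (is_RInt_unique (V := R_CompleteNormedModule) _ _ _ _ H1)|].
      simpl. ring.
    + etransitivity; [exact (is_RInt_unique (V := R_CompleteNormedModule) _ _ _ _ H2)|].
      simpl. ring.
Qed.

Lemma cint_minus (f g : R -> C) (a b : R) :
  ex_cint f a b -> ex_cint g a b ->
  ex_cint (fun t => (f t - g t)%C) a b /\
  cint (fun t => (f t - g t)%C) a b = (cint f a b - cint g a b)%C.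
Proof.
  intros [F1 F2] [G1 G2]. split.
  - split; apply (ex_RInt_minus (V := R_NormedModule)); assumption.
  - apply C_ext; simpl; apply (RInt_minus (V := R_CompleteNormedModule)); assumption.
Qed.

Lemma cint_ext (f g : R -> C) (a b : R) :
  (forall t, f t = g t) -> cint f a b = cint g a b.
Proof.
  intros E. unfold cint. f_equal; apply RInt_ext; intros t _; rewrite E; reflexivity.
Qed.

Lemma cint_Chasles (f : R -> C) (a b c : R) :
  ex_cint f a b -> ex_cint f b c -> (cint f a b + cint f b c)%C = cint f a c.
Proof.
  intros [F1 F2] [G1 G2].
  apply C_ext; simpl; apply (RInt_Chasles (V := R_CompleteNormedModule)); assumption.
Qed.

(* For [l = cint f a b], integrate the real function [Re (Cconj l * f)]. *)
Lemma cint_norm_le (f : R -> C) (a b M : R) :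
  a <= b -> ex_cint f a b -> (forall t, a <= t <= b -> Cmod (f t) <= M) ->
  Cmod (cint f a b) <= M * (b - a).
Proof.
  intros Hab Hf HM. set (l := cint f a b).
  destruct (Req_dec (Cmod l) 0) as [h|h].
  { rewrite h. apply Rmult_le_pos; [|lra].
    eapply Rle_trans; [apply Cmod_ge_0|apply (HM a)]; lra. }
  assert (Hl : 0 < Cmod l) by (pose proof (Cmod_ge_0 l); lra).
  assert (H : is_RInt (fun t => fst l * fst (f t) + snd l * snd (f t)) a b (Cmod l ^ 2)).
  { replace (Cmod l ^ 2) with (fst l * RInt (fun t => fst (f t)) a b
        + snd l * RInt (fun t => snd (f t)) a b).
    - apply is_RInt_lincomb; apply Hf.
    - rewrite Cmod2_alt. unfold Re, Im, l. simpl. ring. }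
  assert (Hle : Cmod l ^ 2 <= Cmod l * M * (b - a)).
  { apply (is_RInt_le _ (fun _ => Cmod l * M) a b _ _ Hab H).
    - replace (Cmod l * M * (b - a)) with (scal (b - a) (Cmod l * M))
        by (unfold scal; simpl; unfold mult; simpl; ring).
      apply (is_RInt_const (V := R_NormedModule)).
    - intros t Ht.
      apply Rle_trans with (Cmod l * Cmod (f t)).
      + rewrite <- (Cmod_conj l), <- Cmod_mult.
        eapply Rle_trans; [|apply fst_le_Cmod]. eapply Rle_trans; [|apply Rle_abs].
        simpl. right. ring.
      + apply Rmult_le_compat_l; [lra|]. apply HM. lra. }
  apply Rmult_le_reg_l with (Cmod l); [exact Hl|]. nra.
Qed.

(** Along an edge of a rectangle an affine function of z is affine in the parameter, which serves
    [rect_int_affine]; the case v = 0 gives the mean of a constant. *)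
Lemma cint_affine (u v : C) (a b : R) :
  ex_cint (fun t => (u + v * RtoC t)%C) a b /\
  cint (fun t => (u + v * RtoC t)%C) a b =
    (u * RtoC (b - a) + v * RtoC ((b ^ 2 - a ^ 2) / 2))%C.
Proof.
  assert (Hlin : forall p q, is_RInt (fun t => p + q * t) a b
    (p * (b - a) + q * ((b ^ 2 - a ^ 2) / 2))).
  { intros p q.
    replace (p * (b - a) + q * ((b ^ 2 - a ^ 2) / 2))
      with (minus (p * b + q * (b ^ 2 / 2)) (p * a + q * (a ^ 2 / 2)))
      by (unfold minus, plus, opp; simpl; field).
    apply (is_RInt_derive (V := R_CompleteNormedModule) (fun t => p * t + q * (t ^ 2 / 2))).
    - intros t _. auto_derive; [exact I|field].
    - intros t _. apply (ex_derive_continuous (K := R_AbsRing) (V := R_NormedModule)).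
      auto_derive. exact I. }
  assert (H1 : is_RInt (fun t => fst (u + v * RtoC t)%C) a b
     (fst (u * RtoC (b - a) + v * RtoC ((b ^ 2 - a ^ 2) / 2))%C)).
  { replace (fst (u * RtoC (b - a) + v * RtoC ((b ^ 2 - a ^ 2) / 2))%C)
      with (fst u * (b - a) + fst v * ((b ^ 2 - a ^ 2) / 2)) by (simpl; ring).
    apply (is_RInt_ext (V := R_NormedModule)) with (2 := Hlin (fst u) (fst v)).
    intros t _. simpl. change (fst u + fst v * t = fst u + (fst v * t - snd v * 0)). ring. }
  assert (H2 : is_RInt (fun t => snd (u + v * RtoC t)%C) a b
     (snd (u * RtoC (b - a) + v * RtoC ((b ^ 2 - a ^ 2) / 2))%C)).
  { replace (snd (u * RtoC (b - a) + v * RtoC ((b ^ 2 - a ^ 2) / 2))%C)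
      with (snd u * (b - a) + snd v * ((b ^ 2 - a ^ 2) / 2)) by (simpl; ring).
    apply (is_RInt_ext (V := R_NormedModule)) with (2 := Hlin (snd u) (snd v)).
    intros t _. simpl. change (snd u + snd v * t = snd u + (fst v * 0 + snd v * t)). ring. }
  split.
  - split; eexists; [exact H1|exact H2].
  - apply C_ext; [apply (is_RInt_unique (V := R_CompleteNormedModule) _ _ _ _ H1)|
      apply (is_RInt_unique (V := R_CompleteNormedModule) _ _ _ _ H2)].
Qed.

(** * Goursat's theorem for rectangles *)

(* The integral along the boundary of [a, b] x [c, d], counterclockwise. *)
Definition rect_int (F : C -> C) (a b c d : R) : C :=
  (cint (fun s => F (s, c)) a b + Ci * cint (fun t => F (b, t)) c d
   - cint (fun s => F (s, d)) a b - Ci * cint (fun t => F (a, t)) c d)%C.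

(** Goursat's bisection, separated from integrals. Halving both sides divides the squared
    half-perimeter by four, so if the bound fails on a rectangle it fails on one of the four
    quarters; the nested failures shrink to a point, where the local bound is contradicted. *)
Lemma rect_bisection (Phi : R -> R -> R -> R -> R) (a0 b0 c0 d0 eta : R) :
  a0 <= b0 -> c0 <= d0 -> 0 < eta ->
  (forall a b c d, a0 <= a <= b -> b <= b0 -> c0 <= c <= d -> d <= d0 ->
     Phi a b c d <=
       Phi a ((a + b) / 2) c ((c + d) / 2) + Phi ((a + b) / 2) b c ((c + d) / 2)
     + (Phi a ((a + b) / 2) ((c + d) / 2) d + Phi ((a + b) / 2) b ((c + d) / 2) d)) ->
  (forall s t, a0 <= s <= b0 -> c0 <= t <= d0 -> exists delta, 0 < delta /\
     forall a b c d, a0 <= a <= s -> s <= b <= b0 -> c0 <= c <= t -> t <= d <= d0 ->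
       (b - a) + (d - c) < delta -> Phi a b c d <= eta * ((b - a) + (d - c)) ^ 2) ->
  Phi a0 b0 c0 d0 <= eta * ((b0 - a0) + (d0 - c0)) ^ 2.
Proof.
  intros Hab Hcd Heta Hsub Hloc.
  apply Rnot_lt_le. intros Hbad0.
  set (bad := fun r : (R * R) * (R * R) =>
    eta * ((snd (fst r) - fst (fst r)) + (snd (snd r) - fst (snd r))) ^ 2 <
    Phi (fst (fst r)) (snd (fst r)) (fst (snd r)) (snd (snd r))).
  set (good := fun r : (R * R) * (R * R) =>
    a0 <= fst (fst r) <= snd (fst r) /\ snd (fst r) <= b0 /\
    c0 <= fst (snd r) <= snd (snd r) /\ snd (snd r) <= d0 /\ bad r).
  (* The hypothesis [good r] stands under the existential so that choice yields a successor function
     defined on all rectangles. *)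
  assert (Hstep : forall r, exists r', good r -> good r' /\
     fst (fst r) <= fst (fst r') /\ snd (fst r') <= snd (fst r) /\
     fst (snd r) <= fst (snd r') /\ snd (snd r') <= snd (snd r) /\
     snd (fst r') - fst (fst r') = (snd (fst r) - fst (fst r)) / 2 /\
     snd (snd r') - fst (snd r') = (snd (snd r) - fst (snd r)) / 2).
  { intros [[a b] [c d]].
    destruct (classic (good ((a, b), (c, d)))) as [Hg|Hg];
      [|exists ((a, b), (c, d)); intros; contradiction].
    unfold good, bad in *; simpl in *.
    destruct Hg as (Ha & Hb & Hc & Hd & Hbad).
    specialize (Hsub a b c d Ha Hb Hc Hd).
    set (p := (a + b) / 2) in *. set (q := (c + d) / 2) in *.
    assert (Hp : a <= p <= b) by (unfold p; lra).
    assert (Hq : c <= q <= d) by (unfold q; lra).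
    assert (Hpa : p - a = (b - a) / 2) by (unfold p; lra).
    assert (Hpb : b - p = (b - a) / 2) by (unfold p; lra).
    assert (Hqc : q - c = (d - c) / 2) by (unfold q; lra).
    assert (Hqd : d - q = (d - c) / 2) by (unfold q; lra).
    assert (HP : forall P, P = (b - a) + (d - c) ->
      eta * ((b - a) / 2 + (d - c) / 2) ^ 2 = eta * P ^ 2 / 4)
      by (intros P ->; field).
    specialize (HP _ eq_refl).
    (* [E] is a quarter of the parent's bound: if no quarter exceeded it, subadditivity would
       contradict [Hbad]. *)
    set (E := eta * ((b - a) / 2 + (d - c) / 2) ^ 2) in *.
    destruct (Rlt_dec E (Phi a p c q)) as [h1|h1].
    { exists ((a, p), (c, q)); intros _; simpl.
      rewrite Hpa, Hqc; fold E; repeat split; lra. }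
    destruct (Rlt_dec E (Phi p b c q)) as [h2|h2].
    { exists ((p, b), (c, q)); intros _; simpl.
      rewrite Hpb, Hqc; fold E; repeat split; lra. }
    destruct (Rlt_dec E (Phi a p q d)) as [h3|h3].
    { exists ((a, p), (q, d)); intros _; simpl.
      rewrite Hpa, Hqd; fold E; repeat split; lra. }
    destruct (Rlt_dec E (Phi p b q d)) as [h4|h4].
    { exists ((p, b), (q, d)); intros _; simpl.
      rewrite Hpb, Hqd; fold E; repeat split; lra. }
    simpl in Hbad. lra. }
  destruct (choice_fun _ _ _ Hstep) as [next Hnext].
  set (r := fix r (n : nat) := match n with
    O => ((a0, b0), (c0, d0)) | S k => next (r k) end).
  assert (Hgood : forall n, good (r n)).
  { induction n as [|n IH].
    - unfold good, bad; simpl. repeat split; lra.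
    - simpl. apply Hnext. exact IH. }
  assert (Hmono : forall n k,
     fst (fst (r n)) <= fst (fst (r (k + n)%nat)) /\
     snd (fst (r (k + n)%nat)) <= snd (fst (r n)) /\
     fst (snd (r n)) <= fst (snd (r (k + n)%nat)) /\
     snd (snd (r (k + n)%nat)) <= snd (snd (r n))).
  { intros n. induction k as [|k IH]; [simpl; lra|].
    change (r (S k + n)%nat) with (next (r (k + n)%nat)).
    pose proof (Hnext _ (Hgood (k + n)%nat)). lra. }
  assert (Hsize : forall n,
     (snd (fst (r n)) - fst (fst (r n))) + (snd (snd (r n)) - fst (snd (r n)))
     = ((b0 - a0) + (d0 - c0)) * (/ 2) ^ n).
  { induction n as [|n IH]; [simpl; ring|].
    change (r (S n)) with (next (r n)).
    pose proof (Hnext _ (Hgood n)) as H. simpl pow.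
    replace ((b0 - a0 + (d0 - c0)) * (/ 2 * (/ 2) ^ n))
      with (((b0 - a0 + (d0 - c0)) * (/ 2) ^ n) / 2) by field.
    lra. }
  assert (Hcross : forall n k,
     fst (fst (r n)) <= snd (fst (r k)) /\ fst (snd (r n)) <= snd (snd (r k))).
  { intros n k.
    pose proof (Hmono n k) as H1. pose proof (Hmono k n) as H2.
    rewrite (PeanoNat.Nat.add_comm n k) in H2.
    pose proof (Hgood (k + n)%nat) as H3. unfold good in H3. lra. }
  (* Nested intervals: the supremum of the left ends lies below every right end. *)
  assert (Hlub : forall u v : nat -> R, (forall n k, u n <= v k) ->
     exists x, forall n, u n <= x <= v n).
  { intros u v Huv.
    destruct (completeness (fun x => exists n, x = u n)) as [x [Hx1 Hx2]].
    - exists (v 0%nat). intros y [n ->]. apply Huv.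
    - exists (u 0%nat). exists 0%nat. reflexivity.
    - exists x. intros n. split.
      + apply Hx1. exists n. reflexivity.
      + apply Hx2. intros y [k ->]. apply Huv. }
  destruct (Hlub (fun n => fst (fst (r n))) (fun n => snd (fst (r n)))) as [s Hs];
    [intros; apply Hcross|].
  destruct (Hlub (fun n => fst (snd (r n))) (fun n => snd (snd (r n)))) as [t Ht];
    [intros; apply Hcross|].
  simpl in Hs, Ht.
  destruct (Hloc s t) as [delta [Hdelta HPhi]].
  { apply (Hs 0%nat). } { apply (Ht 0%nat). }
  (* Adding 1 to the half-perimeter covers the degenerate rectangle. *)
  destruct (pow_lt_1_zero (/ 2)) with (y := delta / ((b0 - a0) + (d0 - c0) + 1)) as [N HN].
  { rewrite Rabs_pos_eq; lra. }
  { apply Rdiv_lt_0_compat; lra. }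
  specialize (HN N (le_n N)).
  rewrite Rabs_pos_eq in HN by (apply pow_le; lra).
  destruct (Hgood N) as (H1 & H2 & H3 & H4 & Hbad). unfold bad in Hbad.
  specialize (Hs N). specialize (Ht N).
  apply (Rlt_not_le _ _ Hbad). apply HPhi; try lra.
  rewrite Hsize.
  apply Rle_lt_trans with (((b0 - a0) + (d0 - c0) + 1) * (/ 2) ^ N).
  - apply Rmult_le_compat_r; [apply pow_le; lra|lra].
  - apply Rmult_lt_compat_l with (r := (b0 - a0) + (d0 - c0) + 1) in HN; [|lra].
    replace ((b0 - a0 + (d0 - c0) + 1) * (delta / (b0 - a0 + (d0 - c0) + 1)))
      with delta in HN by (field; lra).
    exact HN.
Qed.

Lemma Cmod_le_abs (x y : R) : Cmod (x, y) <= Rabs x + Rabs y.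
Proof.
  replace (x, y) with (RtoC x + Ci * RtoC y)%C by (apply C_ext; simpl; ring).
  eapply Rle_trans; [apply Cmod_triangle|].
  rewrite Cmod_mult, Cmod_Ci, !Cmod_R. lra.
Qed.

Lemma cderiv_cont (F : C -> C) (z l : C) :
  cderiv F z l -> forall eps, 0 < eps -> exists delta, 0 < delta /\
    forall w, Cmod (w - z)%C < delta -> Cmod (F w - F z)%C < eps.
Proof.
  intros H eps He. destruct (H 1 Rlt_0_1) as [d [Hd H']].
  assert (Hl : 0 < Cmod l + 1) by (pose proof (Cmod_ge_0 l); lra).
  exists (Rmin d (eps / (Cmod l + 1))). split.
  - apply Rmin_glb_lt; [exact Hd|apply Rdiv_lt_0_compat; assumption].
  - intros w Hw.
    assert (Hw1 := Rlt_le_trans _ _ _ Hw (Rmin_l _ _)).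
    assert (Hw2 := Rlt_le_trans _ _ _ Hw (Rmin_r _ _)).
    specialize (H' w Hw1).
    replace (F w - F z)%C with ((F w - F z - l * (w - z)) + l * (w - z))%C by ring.
    eapply Rle_lt_trans; [apply Cmod_triangle|]. rewrite (Cmod_mult l).
    apply Rlt_div_r in Hw2; [|exact Hl]. lra.
Qed.

Lemma cderiv_ccont_comp (F : C -> C) (p : R -> C) (t : R) (l : C) :
  cderiv F (p t) l -> ccont_at p t -> ccont_at (fun u => F (p u)) t.
Proof.
  intros HF Hp eps He. destruct (cderiv_cont F _ l HF eps He) as [d [Hd H]].
  destruct (Hp d Hd) as [d' [Hd' H']]. exists d'. split; [exact Hd'|].
  intros u Hu. apply H, H', Hu.
Qed.

Lemma ccont_at_horizontal (c t : R) : ccont_at (fun s => (s, c)) t.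
Proof.
  intros eps He. exists eps. split; [exact He|]. intros u Hu.
  eapply Rle_lt_trans; [apply Cmod_le_abs|]. simpl.
  replace (c + - c) with 0 by ring. rewrite Rabs_R0. unfold Rminus in Hu. lra.
Qed.

Lemma ccont_at_vertical (c t : R) : ccont_at (fun s => (c, s)) t.
Proof.
  intros eps He. exists eps. split; [exact He|]. intros u Hu.
  eapply Rle_lt_trans; [apply Cmod_le_abs|]. simpl.
  replace (c + - c) with 0 by ring. rewrite Rabs_R0. unfold Rminus in Hu. lra.
Qed.

Definition cdiff_rect (F : C -> C) (a b c d : R) : Prop :=
  forall s t, a <= s <= b -> c <= t <= d -> exists l, cderiv F (s, t) l.

Lemma ex_cint_horizontal (F : C -> C) (a0 b0 c0 d0 a b c : R) :
  cdiff_rect F a0 b0 c0 d0 -> a0 <= a <= b -> b <= b0 -> c0 <= c <= d0 ->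
  ex_cint (fun s => F (s, c)) a b.
Proof.
  intros HF Ha Hb Hc. apply ex_cint_cont; [lra|]. intros s Hs.
  destruct (HF s c) as [l Hl]; [lra|lra|].
  apply (cderiv_ccont_comp F (fun s => (s, c)) s l Hl). apply ccont_at_horizontal.
Qed.

Lemma ex_cint_vertical (F : C -> C) (a0 b0 c0 d0 a c d : R) :
  cdiff_rect F a0 b0 c0 d0 -> c0 <= c <= d -> d <= d0 -> a0 <= a <= b0 ->
  ex_cint (fun t => F (a, t)) c d.
Proof.
  intros HF Ha Hb Hc. apply ex_cint_cont; [lra|]. intros t Ht.
  destruct (HF a t) as [l Hl]; [lra|lra|].
  apply (cderiv_ccont_comp F (fun t => (a, t)) t l Hl). apply ccont_at_vertical.
Qed.

(** Outer edges are divided by Chasles' relation; each inner edge is traversed in both directions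
    and cancels. *)
Lemma rect_int_split (F : C -> C) (a0 b0 c0 d0 a p b c q d : R) :
  cdiff_rect F a0 b0 c0 d0 ->
  a0 <= a <= p -> p <= b <= b0 -> c0 <= c <= q -> q <= d <= d0 ->
  rect_int F a b c d =
  (rect_int F a p c q + rect_int F p b c q + (rect_int F a p q d + rect_int F p b q d))%C.
Proof.
  intros HF Ha Hb Hc Hd.
  assert (H : forall y, c <= y <= d ->
    cint (fun s => F (s, y)) a b = (cint (fun s => F (s, y)) a p + cint (fun s => F (s, y)) p b)%C).
  { intros y Hy. symmetry. apply cint_Chasles;
      apply (ex_cint_horizontal F a0 b0 c0 d0); try exact HF; lra. }
  assert (V : forall x, a <= x <= b ->
    cint (fun t => F (x, t)) c d = (cint (fun t => F (x, t)) c q + cint (fun t => F (x, t)) q d)%C).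
  { intros y Hy. symmetry. apply cint_Chasles;
      apply (ex_cint_vertical F a0 b0 c0 d0); try exact HF; lra. }
  unfold rect_int. rewrite (H c), (H d), (V a), (V b) by lra. ring.
Qed.

Lemma rect_int_affine (u v : C) (a b c d : R) :
  rect_int (fun z => (u + v * z)%C) a b c d = 0%C.
Proof.
  unfold rect_int.
  assert (H : forall y, cint (fun s => (u + v * (s, y))%C) a b =
     ((u + v * Ci * RtoC y) * RtoC (b - a) + v * RtoC ((b ^ 2 - a ^ 2) / 2))%C).
  { intros y. rewrite <- (proj2 (cint_affine _ _ a b)). apply cint_ext.
    intros s. replace (s, y) with (RtoC s + Ci * RtoC y)%C by (apply C_ext; simpl; ring).
    ring. }
  assert (V : forall x, cint (fun t => (u + v * (x, t))%C) c d =
     ((u + v * RtoC x) * RtoC (d - c) + (v * Ci) * RtoC ((d ^ 2 - c ^ 2) / 2))%C).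
  { intros x. rewrite <- (proj2 (cint_affine _ _ c d)). apply cint_ext.
    intros t. replace (x, t) with (RtoC x + Ci * RtoC t)%C by (apply C_ext; simpl; ring).
    ring. }
  rewrite !H, !V, !RtoC_minus. ring.
Qed.

Lemma rect_int_minus (F G : C -> C) (a b c d : R) :
  a <= b -> c <= d -> cdiff_rect F a b c d -> cdiff_rect G a b c d ->
  rect_int (fun z => (F z - G z)%C) a b c d = (rect_int F a b c d - rect_int G a b c d)%C.
Proof.
  intros Hab Hcd HF HG. unfold rect_int.
  rewrite (proj2 (cint_minus (fun s => F (s, c)) (fun s => G (s, c)) a b
     (ex_cint_horizontal F a b c d a b c HF ltac:(lra) ltac:(lra) ltac:(lra))
     (ex_cint_horizontal G a b c d a b c HG ltac:(lra) ltac:(lra) ltac:(lra)))).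
  rewrite (proj2 (cint_minus (fun s => F (s, d)) (fun s => G (s, d)) a b
     (ex_cint_horizontal F a b c d a b d HF ltac:(lra) ltac:(lra) ltac:(lra))
     (ex_cint_horizontal G a b c d a b d HG ltac:(lra) ltac:(lra) ltac:(lra)))).
  rewrite (proj2 (cint_minus (fun t => F (a, t)) (fun t => G (a, t)) c d
     (ex_cint_vertical F a b c d a c d HF ltac:(lra) ltac:(lra) ltac:(lra))
     (ex_cint_vertical G a b c d a c d HG ltac:(lra) ltac:(lra) ltac:(lra)))).
  rewrite (proj2 (cint_minus (fun t => F (b, t)) (fun t => G (b, t)) c d
     (ex_cint_vertical F a b c d b c d HF ltac:(lra) ltac:(lra) ltac:(lra))
     (ex_cint_vertical G a b c d b c d HG ltac:(lra) ltac:(lra) ltac:(lra)))).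
  ring.
Qed.

Lemma rect_int_norm_le (F : C -> C) (a b c d M : R) :
  a <= b -> c <= d -> cdiff_rect F a b c d ->
  (forall s t, a <= s <= b -> c <= t <= d -> Cmod (F (s, t)) <= M) ->
  Cmod (rect_int F a b c d) <= 2 * M * ((b - a) + (d - c)).
Proof.
  intros Hab Hcd HF HM.
  assert (H1 : Cmod (cint (fun s => F (s, c)) a b) <= M * (b - a)).
  { apply cint_norm_le; [exact Hab| |intros; apply HM; lra].
    apply (ex_cint_horizontal F a b c d); try exact HF; lra. }
  assert (H2 : Cmod (cint (fun s => F (s, d)) a b) <= M * (b - a)).
  { apply cint_norm_le; [exact Hab| |intros; apply HM; lra].
    apply (ex_cint_horizontal F a b c d); try exact HF; lra. }
  assert (H3 : Cmod (cint (fun t => F (a, t)) c d) <= M * (d - c)).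
  { apply cint_norm_le; [exact Hcd| |intros; apply HM; lra].
    apply (ex_cint_vertical F a b c d); try exact HF; lra. }
  assert (H4 : Cmod (cint (fun t => F (b, t)) c d) <= M * (d - c)).
  { apply cint_norm_le; [exact Hcd| |intros; apply HM; lra].
    apply (ex_cint_vertical F a b c d); try exact HF; lra. }
  unfold rect_int.
  eapply Rle_trans; [apply Cmod_triangle_sub|]. rewrite Cmod_mult, Cmod_Ci.
  eapply Rle_trans; [apply Rplus_le_compat_r, Cmod_triangle_sub|].
  eapply Rle_trans; [apply Rplus_le_compat_r, Rplus_le_compat_r, Cmod_triangle|].
  rewrite Cmod_mult, Cmod_Ci. lra.
Qed.

Lemma cderiv_affine (u v z : C) : cderiv (fun w => (u + v * w)%C) z v.
Proof.
  intros eps He. exists 1. split; [lra|]. intros w _.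
  replace (u + v * w - (u + v * z) - v * (w - z))%C with (RtoC 0) by ring.
  rewrite Cmod_0. apply Rmult_le_pos; [lra|apply Cmod_ge_0].
Qed.

Lemma cderiv_minus (F G : C -> C) (z l k : C) :
  cderiv F z l -> cderiv G z k -> cderiv (fun w => (F w - G w)%C) z (l - k)%C.
Proof.
  rewrite !cderiv_is_derive. apply (is_derive_minus (V := C_NormedModule)).
Qed.

(** Near a point the tangent affine map is subtracted, which leaves the boundary integral unchanged.
    The remainder is at most eta / 2 times the half-perimeter p on a contour of length 2 p, so the
    integral is at most eta p^2, as the bisection asks; eta is then arbitrary. *)
Theorem goursat (F : C -> C) (a b c d : R) :
  a <= b -> c <= d -> cdiff_rect F a b c d -> rect_int F a b c d = 0%C.
Proof.
  intros Hab Hcd HF. apply Cmod_eq_0. apply Rle_antisym; [|apply Cmod_ge_0].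
  set (P := (b - a) + (d - c)).
  assert (H : forall eta, 0 < eta -> Cmod (rect_int F a b c d) <= eta * P ^ 2).
  { intros eta Heta.
    apply (rect_bisection (fun a b c d => Cmod (rect_int F a b c d))); try assumption.
    - intros a' b' c' d' Ha Hb Hc Hd.
      rewrite (rect_int_split F a b c d a' ((a' + b') / 2) b' c' ((c' + d') / 2) d' HF)
        by lra.
      eapply Rle_trans; [apply Cmod_triangle|].
      apply Rplus_le_compat; apply Cmod_triangle.
    - intros s t Hs Ht. destruct (HF s t Hs Ht) as [l Hl].
      destruct (Hl (eta / 2)) as [delta [Hdelta HD]]; [lra|].
      exists delta. split; [exact Hdelta|].
      intros a' b' c' d' Ha Hb Hc Hd Hsz.
      set (u := (F (s, t) - l * (s, t))%C).
      assert (HF' : cdiff_rect F a' b' c' d') by (intros x y Hx Hy; apply HF; lra).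
      assert (HA : cdiff_rect (fun z => (u + l * z)%C) a' b' c' d').
      { intros x y _ _. exists l. apply cderiv_affine. }
      replace (rect_int F a' b' c' d')
        with (rect_int (fun z => (F z - (u + l * z))%C) a' b' c' d').
      2:{ rewrite rect_int_minus, rect_int_affine by (assumption || lra). ring. }
      set (p := (b' - a') + (d' - c')) in *.
      replace (eta * p ^ 2) with (2 * (eta / 2 * p) * p) by field.
      apply rect_int_norm_le; [lra|lra| |].
      + intros x y Hx Hy. destruct (HF' x y Hx Hy) as [k Hk].
        exists (k - l)%C. apply cderiv_minus; [exact Hk|apply cderiv_affine].
      + intros x y Hx Hy.
        assert (Hdist : Cmod ((x, y) - (s, t))%C <= p).
        { eapply Rle_trans; [apply (Cmod_le_abs (x + - s) (y + - t))|]. unfold p.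
          apply Rplus_le_compat; apply Rabs_le; lra. }
        replace (F (x, y) - (u + l * (x, y)))%C
          with (F (x, y) - F (s, t) - l * ((x, y) - (s, t)))%C by (unfold u; ring).
        eapply Rle_trans; [apply HD; lra|].
        apply Rmult_le_compat_l; lra. }
  apply Rle_plus_eps. intros eps He.
  specialize (H (eps / (P ^ 2 + 1))).
  assert (0 <= P ^ 2) by apply pow2_ge_0.
  assert (Hp : 0 < eps / (P ^ 2 + 1)) by (apply Rdiv_lt_0_compat; lra).
  specialize (H Hp). rewrite Rplus_0_l. eapply Rle_trans; [exact H|].
  replace eps with (eps / (P ^ 2 + 1) * (P ^ 2 + 1)) at 2 by (field; lra).
  apply Rmult_le_compat_l; lra.
Qed.

(** * The complex exponential *)

Definition cexp (w : C) : C := (exp (fst w) * cos (snd w), exp (fst w) * sin (snd w)).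

Lemma cexp_plus (x y : C) : cexp (x + y)%C = (cexp x * cexp y)%C.
Proof.
  apply C_ext; simpl; rewrite exp_plus, ?cos_plus, ?sin_plus; ring.
Qed.

Lemma Cmod_cexp (w : C) : Cmod (cexp w) = exp (fst w).
Proof.
  unfold Cmod, cexp; simpl fst; simpl snd.
  replace ((exp (fst w) * cos (snd w)) ^ 2 + (exp (fst w) * sin (snd w)) ^ 2)
    with (exp (fst w) ^ 2 * (Rsqr (sin (snd w)) + Rsqr (cos (snd w))))
    by (unfold Rsqr; ring).
  rewrite sin2_cos2, Rmult_1_r. apply sqrt_pow2, Rlt_le, exp_pos.
Qed.

Lemma derivable_pt_lim_0_eps (f : R -> R) (l : R) :
  derivable_pt_lim f 0 l -> forall eps, 0 < eps -> exists delta, 0 < delta /\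
    forall h, Rabs h < delta -> Rabs (f h - f 0 - l * h) <= eps * Rabs h.
Proof.
  intros H eps He. destruct (H eps He) as [d Hd].
  exists d. split; [apply cond_pos|]. intros h Hh.
  destruct (Req_dec h 0) as [->|hn].
  - replace (f 0 - f 0 - l * 0) with 0 by ring. rewrite Rabs_R0. lra.
  - specialize (Hd h hn Hh). rewrite Rplus_0_l in Hd.
    replace (f h - f 0 - l * h) with (((f h - f 0) / h - l) * h) by (field; exact hn).
    rewrite Rabs_mult. apply Rmult_le_compat_r; [apply Rabs_pos|lra].
Qed.

Lemma cderiv_cexp_0 : cderiv cexp 0 1.
Proof.
  intros eps He.
  (* The real and imaginary parts of the remainder are each bounded by 3 e |w|, whence the 6. *)
  set (e := Rmin 1 (eps / 6)).
  assert (He0 : 0 < e) by (apply Rmin_glb_lt; lra).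
  assert (He1 : e <= 1) by apply Rmin_l.
  assert (He6 : e <= eps / 6) by apply Rmin_r.
  destruct (derivable_pt_lim_0_eps exp 1) with (eps := e) as [d1 [Hd1 H1]];
    [rewrite <- exp_0; apply derivable_pt_lim_exp|exact He0|].
  assert (Hcos : derivable_pt_lim cos 0 0).
  { pose proof (derivable_pt_lim_cos 0) as H. rewrite sin_0, Ropp_0 in H. exact H. }
  destruct (derivable_pt_lim_0_eps cos 0 Hcos e He0) as [d2 [Hd2 H2]].
  destruct (derivable_pt_lim_0_eps sin 1) with (eps := e) as [d3 [Hd3 H3]];
    [rewrite <- cos_0; apply derivable_pt_lim_sin|exact He0|].
  rewrite exp_0 in H1. rewrite cos_0 in H2. rewrite sin_0 in H3.
  (* With |s| < e / 2 and e <= 1, |exp s - 1| <= (1 + e) |s| <= e. *)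
  exists (Rmin (Rmin d1 d2) (Rmin d3 (e / 2))).
  split; [repeat apply Rmin_glb_lt; lra|].
  intros [s t] Hw.
  replace ((s, t) - 0)%C with ((s, t) : C) in * by (apply C_ext; simpl; ring).
  pose proof (Rmin_l (Rmin d1 d2) (Rmin d3 (e / 2))).
  pose proof (Rmin_r (Rmin d1 d2) (Rmin d3 (e / 2))).
  pose proof (Rmin_l d1 d2). pose proof (Rmin_r d1 d2).
  pose proof (Rmin_l d3 (e / 2)). pose proof (Rmin_r d3 (e / 2)).
  pose proof (fst_le_Cmod (s, t)) as Hs. pose proof (snd_le_Cmod (s, t)) as Ht.
  simpl in Hs, Ht.
  specialize (H1 s ltac:(lra)). specialize (H2 t ltac:(lra)). specialize (H3 t ltac:(lra)).
  set (n := Cmod (s, t)) in *.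
  pose proof (Rabs_pos s). pose proof (Rabs_pos t).
  assert (Hexp1 : Rabs (exp s - 1) <= e).
  { replace (exp s - 1) with ((exp s - 1 - 1 * s) + s) by ring.
    eapply Rle_trans; [apply Rabs_triang|]. nra. }
  assert (Hexp : Rabs (exp s) <= 2).
  { replace (exp s) with ((exp s - 1) + 1) by ring.
    eapply Rle_trans; [apply Rabs_triang|]. rewrite Rabs_R1. lra. }
  assert (Hsin : Rabs (sin t) <= 2 * Rabs t).
  { replace (sin t) with ((sin t - 0 - 1 * t) + t) by ring.
    eapply Rle_trans; [apply Rabs_triang|]. nra. }
  (* The remainder is regrouped into the first-order errors of exp, cos and sin and the product (exp
     s - 1) sin t, which is of second order. *)
  match goal with |- Cmod ?x <= _ => replace x with
     ((((exp s - 1 - 1 * s) + exp s * (cos t - 1 - 0 * t)),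
       ((exp s - 1) * sin t + (sin t - 0 - 1 * t))) : C) end.
  2:{ apply C_ext; unfold cexp; simpl; rewrite exp_0, ?cos_0, ?sin_0; ring. }
  eapply Rle_trans; [apply Cmod_le_abs|].
  assert (K1 : Rabs (exp s - 1 - 1 * s + exp s * (cos t - 1 - 0 * t)) <= e * n + 2 * (e * n)).
  { eapply Rle_trans; [apply Rabs_triang|]. rewrite Rabs_mult.
    apply Rplus_le_compat; [nra|].
    apply Rmult_le_compat; try apply Rabs_pos; [exact Hexp|nra]. }
  assert (K2 : Rabs ((exp s - 1) * sin t + (sin t - 0 - 1 * t)) <= e * (2 * n) + e * n).
  { eapply Rle_trans; [apply Rabs_triang|]. rewrite Rabs_mult.
    apply Rplus_le_compat; [|nra].
    apply Rmult_le_compat; try apply Rabs_pos; [exact Hexp1|nra]. }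
  assert (0 <= n) by apply Cmod_ge_0.
  nra.
Qed.

(** The addition formula transports the derivative at 0, with the error scaled by |e^w|. *)
Lemma cderiv_cexp (w : C) : cderiv cexp w (cexp w).
Proof.
  intros eps He.
  assert (Hp : 0 < Cmod (cexp w)) by (rewrite Cmod_cexp; apply exp_pos).
  destruct (cderiv_cexp_0 (eps / Cmod (cexp w))) as [d [Hd H]];
    [apply Rdiv_lt_0_compat; assumption|].
  exists d. split; [exact Hd|]. intros v Hv.
  specialize (H (v - w)%C).
  replace (v - w - 0)%C with (v - w)%C in H by ring.
  specialize (H Hv).
  assert (E0 : cexp 0 = 1%C)
    by (apply C_ext; unfold cexp; simpl; rewrite exp_0, ?cos_0, ?sin_0; ring).
  rewrite E0 in H.
  replace (cexp v) with (cexp w * cexp (v - w))%C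
    by (rewrite <- cexp_plus; f_equal; ring).
  replace (cexp w * cexp (v - w) - cexp w - cexp w * (v - w))%C
    with (cexp w * (cexp (v - w) - 1 - 1 * (v - w)))%C by ring.
  rewrite Cmod_mult.
  apply Rmult_le_compat_l with (r := Cmod (cexp w)) in H; [|lra].
  eapply Rle_trans; [exact H|]. right. field. lra.
Qed.

Lemma cderiv_mult (f g : C -> C) (z l k : C) :
  cderiv f z l -> cderiv g z k -> cderiv (fun w => (f w * g w)%C) z (l * g z + f z * k)%C.
Proof.
  rewrite !cderiv_is_derive_ring. intros Hf Hg.
  exact (is_derive_mult (K := C_AbsRing) f g z l k Hf Hg Cmult_comm).
Qed.

Lemma cderiv_comp (f g : C -> C) (z l k : C) :
  cderiv f (g z) l -> cderiv g z k -> cderiv (fun w => f (g w)) z (k * l)%C.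
Proof.
  rewrite !cderiv_is_derive_ring. intros Hf Hg.
  exact (is_derive_comp (K := C_AbsRing) (V := AbsRing_NormedModule C_AbsRing) f g z l k Hf Hg).
Qed.

(** * Fourier coefficients and Bessel's inequality *)

Definition ccont (f : R -> C) : Prop := forall t, ccont_at f t.

Lemma ccont_const (k : C) : ccont (fun _ => k).
Proof.
  intros t eps He. exists 1. split; [lra|]. intros u _.
  replace (k - k)%C with (RtoC 0) by ring. rewrite Cmod_0. exact He.
Qed.

Lemma ccont_plus (f g : R -> C) : ccont f -> ccont g -> ccont (fun t => (f t + g t)%C).
Proof.
  intros Hf Hg t eps He.
  destruct (Hf t (eps / 2)) as [d1 [Hd1 H1]]; [lra|].
  destruct (Hg t (eps / 2)) as [d2 [Hd2 H2]]; [lra|].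
  exists (Rmin d1 d2). split; [apply Rmin_glb_lt; lra|]. intros u Hu.
  assert (Hu1 := Rlt_le_trans _ _ _ Hu (Rmin_l _ _)).
  assert (Hu2 := Rlt_le_trans _ _ _ Hu (Rmin_r _ _)).
  replace (f u + g u - (f t + g t))%C with ((f u - f t) + (g u - g t))%C by ring.
  eapply Rle_lt_trans; [apply Cmod_triangle|].
  specialize (H1 u Hu1). specialize (H2 u Hu2). lra.
Qed.

Lemma ccont_at_mult (f g : R -> C) (t : R) :
  ccont_at f t -> ccont_at g t -> ccont_at (fun t => (f t * g t)%C) t.
Proof.
  intros Hf Hg eps He.
  set (A := Cmod (f t) + Cmod (g t) + 1).
  pose proof (Cmod_ge_0 (f t)). pose proof (Cmod_ge_0 (g t)).
  assert (HA : 0 < A) by (unfold A; lra).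
  set (e := Rmin 1 (eps / (2 * A))).
  assert (He0 : 0 < e) by (apply Rmin_glb_lt; [lra|apply Rdiv_lt_0_compat; lra]).
  assert (He1 : e <= 1) by apply Rmin_l.
  assert (He2 : e * A <= eps / 2).
  { replace (eps / 2) with (eps / (2 * A) * A) by (field; lra).
    apply Rmult_le_compat_r; [lra|apply Rmin_r]. }
  destruct (Hf e He0) as [d1 [Hd1 H1]]. destruct (Hg e He0) as [d2 [Hd2 H2]].
  exists (Rmin d1 d2). split; [apply Rmin_glb_lt; lra|]. intros u Hu.
  assert (Hu1 := Rlt_le_trans _ _ _ Hu (Rmin_l _ _)).
  assert (Hu2 := Rlt_le_trans _ _ _ Hu (Rmin_r _ _)).
  specialize (H1 u Hu1). specialize (H2 u Hu2).
  replace (f u * g u - f t * g t)%C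
    with ((f u - f t) * (g u - g t) + (f t * (g u - g t) + g t * (f u - f t)))%C by ring.
  eapply Rle_lt_trans; [apply Cmod_triangle|].
  eapply Rle_lt_trans; [apply Rplus_le_compat_l, Cmod_triangle|].
  rewrite !Cmod_mult.
  pose proof (Cmod_ge_0 (f u - f t)%C). pose proof (Cmod_ge_0 (g u - g t)%C).
  unfold A in He2. nra.
Qed.

Lemma ccont_mult (f g : R -> C) : ccont f -> ccont g -> ccont (fun t => (f t * g t)%C).
Proof. intros Hf Hg t. apply ccont_at_mult; [apply Hf|apply Hg]. Qed.

Lemma ccont_conj (f : R -> C) : ccont f -> ccont (fun t => Cconj (f t)).
Proof.
  intros Hf t eps He. destruct (Hf t eps He) as [d [Hd H]].
  exists d. split; [exact Hd|]. intros u Hu.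
  rewrite <- Cminus_conj, Cmod_conj. apply H, Hu.
Qed.

Lemma ccont_minus (f g : R -> C) : ccont f -> ccont g -> ccont (fun t => (f t - g t)%C).
Proof.
  intros Hf Hg t eps He.
  destruct (ccont_plus f _ Hf (ccont_mult _ g (ccont_const (RtoC (-1))) Hg) t eps He)
    as [d [Hd H]].
  exists d. split; [exact Hd|]. intros u Hu. specialize (H u Hu).
  replace (f u - g u - (f t - g t))%C
    with (f u + RtoC (-1) * g u - (f t + RtoC (-1) * g t))%C by ring. exact H.
Qed.

Definition cis (t : R) : C := cexp (0, t).

Lemma cis_plus (s t : R) : cis (s + t) = (cis s * cis t)%C.
Proof. unfold cis. rewrite <- cexp_plus. f_equal. apply C_ext; simpl; ring. Qed.

Lemma Cmod_cis (t : R) : Cmod (cis t) = 1.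
Proof. unfold cis. rewrite Cmod_cexp. apply exp_0. Qed.

Lemma cis_0 : cis 0 = 1%C.
Proof. apply C_ext; unfold cis, cexp; simpl; rewrite exp_0, ?cos_0, ?sin_0; ring. Qed.

Lemma cis_conj (t : R) : Cconj (cis t) = cis (- t).
Proof. apply C_ext; unfold cis, cexp; simpl; rewrite ?cos_neg, ?sin_neg; ring. Qed.

Lemma ccont_cis (k : R) : ccont (fun t => cis (k * t)).
Proof.
  intros t.
  apply (cderiv_ccont_comp cexp (fun u => (0, k * u)) t (cexp (0, k * t))).
  - apply cderiv_cexp.
  - intros eps He. exists (eps / (Rabs k + 1)). pose proof (Rabs_pos k).
    split; [apply Rdiv_lt_0_compat; lra|]. intros u Hu.
    eapply Rle_lt_trans; [apply Cmod_le_abs|]. simpl.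
    replace (0 + - 0) with 0 by ring. rewrite Rabs_R0.
    replace (k * u + - (k * t)) with (k * (u - t)) by ring.
    rewrite Rabs_mult. apply Rlt_div_r in Hu; [|lra].
    pose proof (Rabs_pos (u - t)). nra.
Qed.

Definition mean (f : R -> C) : C := (RtoC (/ (2 * PI)) * cint f 0 (2 * PI))%C.

Lemma two_PI_pos : 0 < 2 * PI.
Proof. pose proof PI_RGT_0. lra. Qed.

Lemma ccont_ex_cint (f : R -> C) : ccont f -> ex_cint f 0 (2 * PI).
Proof. intros H. apply ex_cint_cont; [pose proof two_PI_pos; lra|]. intros; apply H. Qed.

Lemma mean_ext (f g : R -> C) : (forall t, f t = g t) -> mean f = mean g.
Proof. intros E. unfold mean. f_equal. apply cint_ext, E. Qed.

Lemma mean_plus (f g : R -> C) :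
  ccont f -> ccont g -> mean (fun t => (f t + g t)%C) = (mean f + mean g)%C.
Proof.
  intros Hf Hg. unfold mean.
  rewrite (proj2 (cint_plus f g 0 (2 * PI) (ccont_ex_cint f Hf) (ccont_ex_cint g Hg))). ring.
Qed.

Lemma mean_minus (f g : R -> C) :
  ccont f -> ccont g -> mean (fun t => (f t - g t)%C) = (mean f - mean g)%C.
Proof.
  intros Hf Hg. unfold mean.
  rewrite (proj2 (cint_minus f g 0 (2 * PI) (ccont_ex_cint f Hf) (ccont_ex_cint g Hg))). ring.
Qed.

Lemma mean_scal (k : C) (f : R -> C) :
  ccont f -> mean (fun t => (k * f t)%C) = (k * mean f)%C.
Proof.
  intros Hf. unfold mean. rewrite (proj2 (cint_scal k f 0 (2 * PI) (ccont_ex_cint f Hf))). ring.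
Qed.

Lemma mean_const (k : C) : mean (fun _ => k) = k.
Proof.
  unfold mean. rewrite (cint_ext _ (fun t => (k + 0 * RtoC t)%C)) by (intros; ring).
  rewrite (proj2 (cint_affine k 0 0 (2 * PI))).
  rewrite Rminus_0_r, Cmult_0_l, Cplus_0_r, (Cmult_comm k), Cmult_assoc, <- RtoC_mult.
  rewrite Rinv_l by (pose proof two_PI_pos; lra). ring.
Qed.

Lemma mean_conj (f : R -> C) : ccont f -> mean (fun t => Cconj (f t)) = Cconj (mean f).
Proof.
  intros Hf. unfold mean. rewrite Cmult_conj.
  replace (Cconj (RtoC (/ (2 * PI)))) with (RtoC (/ (2 * PI)))
    by (apply C_ext; simpl; ring).
  f_equal. apply C_ext; simpl; [reflexivity|].
  apply (RInt_opp (V := R_CompleteNormedModule)). apply (ccont_ex_cint f Hf).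
Qed.

Lemma cis_period (m : Z) : cis (IZR m * (2 * PI)) = 1%C.
Proof.
  assert (Hs : sin (IZR m * PI) = 0) by (apply sin_eq_0_1; exists m; reflexivity).
  apply C_ext; unfold cis, cexp; simpl; rewrite exp_0, Rmult_1_l;
    replace (IZR m * (2 * PI)) with (2 * (IZR m * PI)) by ring.
  - rewrite cos_2a_sin, Hs. ring.
  - rewrite sin_2a, Hs. ring.
Qed.

Lemma mean_cis (m : Z) : m <> 0%Z -> mean (fun t => cis (IZR m * t)) = 0%C.
Proof.
  intros Hm. assert (Hk : IZR m <> 0) by (apply not_0_IZR; exact Hm).
  pose proof (cis_period m) as Hp. unfold cis, cexp in Hp. simpl in Hp.
  rewrite exp_0, !Rmult_1_l in Hp. injection Hp as Hc Hs.
  set (k := IZR m) in *.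
  assert (H1 : is_RInt (fun t => fst (cis (k * t))) 0 (2 * PI) 0).
  { apply (is_RInt_ext (V := R_NormedModule) (fun t => cos (k * t))).
    { intros t _. unfold cis, cexp. simpl. rewrite exp_0. symmetry. apply Rmult_1_l. }
    replace 0 with (minus (sin (k * (2 * PI)) / k) (sin (k * 0) / k)) at 2.
    2:{ rewrite Hs, Rmult_0_r, sin_0. unfold minus, plus, opp; simpl. field. exact Hk. }
    apply (is_RInt_derive (V := R_CompleteNormedModule) (fun t => sin (k * t) / k)).
    - intros t _. auto_derive; [exact I|field; exact Hk].
    - intros t _. apply (ex_derive_continuous (K := R_AbsRing) (V := R_NormedModule)).
      auto_derive. exact I. }
  assert (H2 : is_RInt (fun t => snd (cis (k * t))) 0 (2 * PI) 0).
  { apply (is_RInt_ext (V := R_NormedModule) (fun t => sin (k * t))).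
    { intros t _. unfold cis, cexp. simpl. rewrite exp_0. symmetry. apply Rmult_1_l. }
    replace 0 with (minus (- cos (k * (2 * PI)) / k) (- cos (k * 0) / k)) at 2.
    2:{ rewrite Hc, Rmult_0_r, cos_0. unfold minus, plus, opp; simpl. field. exact Hk. }
    apply (is_RInt_derive (V := R_CompleteNormedModule) (fun t => - cos (k * t) / k)).
    - intros t _. auto_derive; [exact I|field; exact Hk].
    - intros t _. apply (ex_derive_continuous (K := R_AbsRing) (V := R_NormedModule)).
      auto_derive. exact I. }
  unfold mean. replace (cint _ 0 (2 * PI)) with (RtoC 0); [ring|].
  symmetry. apply C_ext; [exact (is_RInt_unique (V := R_CompleteNormedModule) _ _ _ _ H1)|
    exact (is_RInt_unique (V := R_CompleteNormedModule) _ _ _ _ H2)].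
Qed.

Definition fcoef (f : R -> C) (m : Z) : C := mean (fun t => (f t * cis (- IZR m * t))%C).

Lemma ccont_mul_cis (f : R -> C) (k : R) : ccont f -> ccont (fun t => (f t * cis (k * t))%C).
Proof. intros Hf. apply ccont_mult; [exact Hf|apply ccont_cis]. Qed.

Lemma fcoef_ext (f g : R -> C) (m : Z) : (forall t, f t = g t) -> fcoef f m = fcoef g m.
Proof. intros E. apply mean_ext. intros t. rewrite E. reflexivity. Qed.

Lemma fcoef_plus (f g : R -> C) (m : Z) :
  ccont f -> ccont g -> fcoef (fun t => (f t + g t)%C) m = (fcoef f m + fcoef g m)%C.
Proof.
  intros Hf Hg. unfold fcoef. rewrite <- mean_plus by (apply ccont_mul_cis; assumption).
  apply mean_ext. intros t. ring.
Qed.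

Lemma fcoef_minus (f g : R -> C) (m : Z) :
  ccont f -> ccont g -> fcoef (fun t => (f t - g t)%C) m = (fcoef f m - fcoef g m)%C.
Proof.
  intros Hf Hg. unfold fcoef. rewrite <- mean_minus by (apply ccont_mul_cis; assumption).
  apply mean_ext. intros t. ring.
Qed.

Lemma fcoef_scal (k : C) (f : R -> C) (m : Z) :
  ccont f -> fcoef (fun t => (k * f t)%C) m = (k * fcoef f m)%C.
Proof.
  intros Hf. unfold fcoef. rewrite <- mean_scal by (apply ccont_mul_cis; assumption).
  apply mean_ext. intros t. ring.
Qed.

Lemma fcoef_shift (f : R -> C) (j m : Z) :
  fcoef (fun t => (cis (IZR j * t) * f t)%C) m = fcoef f (m - j).
Proof.
  apply mean_ext. intros t.
  replace (- IZR (m - j) * t) with (IZR j * t + - IZR m * t) by (rewrite minus_IZR; ring).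
  rewrite cis_plus. ring.
Qed.

Lemma fcoef_const (k : C) (m : Z) :
  fcoef (fun _ => k) m = if Z.eq_dec m 0 then k else 0%C.
Proof.
  unfold fcoef. rewrite mean_scal by apply ccont_cis. destruct (Z.eq_dec m 0) as [->|h].
  - rewrite (mean_ext _ (fun _ => 1%C)), mean_const; [ring|].
    intros t. replace (- IZR 0 * t) with 0 by (simpl; ring). apply cis_0.
  - rewrite (mean_ext _ (fun t => cis (IZR (- m) * t))), mean_cis; [ring|lia|].
    intros t. rewrite opp_IZR. reflexivity.
Qed.

Lemma fcoef_cis (k : C) (j m : Z) :
  fcoef (fun t => (k * cis (IZR j * t))%C) m = if Z.eq_dec m j then k else 0%C.
Proof.
  rewrite (fcoef_ext _ (fun t => (cis (IZR j * t) * k)%C)) by (intros; ring).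
  rewrite fcoef_shift, fcoef_const.
  destruct (Z.eq_dec (m - j) 0), (Z.eq_dec m j); reflexivity || lia.
Qed.

Lemma ccont_cis_scal (k : C) (j : Z) : ccont (fun t => (k * cis (IZR j * t))%C).
Proof. apply ccont_mult; [apply ccont_const|apply ccont_cis]. Qed.

(** * Square means and Bessel's inequality *)

Definition mean_sq (f : R -> C) : R := / (2 * PI) * RInt (fun t => Cmod (f t) ^ 2) 0 (2 * PI).

Lemma ex_RInt_mean_sq (f : R -> C) :
  ccont f -> ex_RInt (fun t => Cmod (f t) ^ 2) 0 (2 * PI).
Proof.
  intros Hf.
  destruct (ccont_ex_cint _ (ccont_mult _ _ Hf (ccont_conj f Hf))) as [H _].
  apply ex_RInt_ext with (2 := H). intros t _.
  rewrite <- Cmod2_conj. reflexivity.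
Qed.

(** Lets identities for square means be derived by linearity of the complex [mean], while
    inequalities are proved on the real integral. *)
Lemma mean_sq_mean (f : R -> C) :
  RtoC (mean_sq f) = mean (fun t => (f t * Cconj (f t))%C).
Proof.
  unfold mean_sq, mean. rewrite RtoC_mult. f_equal.
  rewrite (cint_ext _ (fun t => RtoC (Cmod (f t) ^ 2)))
    by (intros t; symmetry; apply Cmod2_conj).
  apply C_ext; simpl; [reflexivity|].
  rewrite RInt_const. unfold scal; simpl; unfold mult; simpl. ring.
Qed.

(** One comparison for three situations: multiplication by a bounded function (q = 0), uniform
    approximation within 1 (p = q = 2), and a function of bounded modulus (p = 0). *)
Lemma mean_sq_lincomb_le (f g : R -> C) (p q : R) :
  ccont f -> ccont g -> (forall t, Cmod (f t) ^ 2 <= p * Cmod (g t) ^ 2 + q) ->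
  mean_sq f <= p * mean_sq g + q.
Proof.
  intros Hf Hg H. pose proof two_PI_pos as HP.
  assert (Hg' := ex_RInt_mean_sq g Hg).
  assert (HI : is_RInt (fun t => p * Cmod (g t) ^ 2 + q) 0 (2 * PI)
    (p * RInt (fun t => Cmod (g t) ^ 2) 0 (2 * PI) + q * (2 * PI))).
  { apply (is_RInt_plus (V := R_NormedModule) (fun t => scal p (Cmod (g t) ^ 2)) (fun _ => q)).
    - apply (is_RInt_scal (V := R_NormedModule)).
      apply (RInt_correct (V := R_CompleteNormedModule)), Hg'.
    - replace (q * (2 * PI)) with (scal (2 * PI - 0) q)
        by (unfold scal; simpl; unfold mult; simpl; ring).
      apply (is_RInt_const (V := R_NormedModule)). }
  assert (Hle : RInt (fun t => Cmod (f t) ^ 2) 0 (2 * PI) <=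
     p * RInt (fun t => Cmod (g t) ^ 2) 0 (2 * PI) + q * (2 * PI)).
  { apply (is_RInt_le (fun t => Cmod (f t) ^ 2) (fun t => p * Cmod (g t) ^ 2 + q) 0 (2 * PI));
      [lra| |exact HI|intros t _; apply H].
    apply (RInt_correct (V := R_CompleteNormedModule)), ex_RInt_mean_sq, Hf. }
  unfold mean_sq.
  apply Rmult_le_compat_l with (r := / (2 * PI)) in Hle.
  - eapply Rle_trans; [exact Hle|]. right. field. pose proof PI_RGT_0. lra.
  - apply Rlt_le, Rinv_0_lt_compat, HP.
Qed.

Lemma mean_sq_nonneg (f : R -> C) : ccont f -> 0 <= mean_sq f.
Proof.
  intros Hf. pose proof two_PI_pos. apply Rmult_le_pos.
  - apply Rlt_le, Rinv_0_lt_compat. lra.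
  - apply RInt_ge_0; [lra|apply ex_RInt_mean_sq, Hf|].
    intros t _. apply pow2_ge_0.
Qed.

(** Pythagoras: in the expansion of |f - c e_m|^2 both cross terms have mean |c|^2, because c is the
    mean of f times the conjugate of e_m. *)
Lemma mean_sq_remove (f : R -> C) (m : Z) :
  ccont f ->
  mean_sq (fun t => (f t - fcoef f m * cis (IZR m * t))%C) = mean_sq f - Cmod (fcoef f m) ^ 2.
Proof.
  intros Hf. set (c := fcoef f m).
  cut (RtoC (mean_sq (fun t => (f t - c * cis (IZR m * t))%C)) =
       RtoC (mean_sq f - Cmod c ^ 2)); [intros E; exact (f_equal fst E)|].
  rewrite mean_sq_mean, RtoC_minus, mean_sq_mean.
  set (e := fun t => cis (- IZR m * t)).
  assert (He : ccont (fun t => (f t * e t)%C)) by (apply ccont_mul_cis, Hf).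
  assert (Hff := ccont_mult _ _ Hf (ccont_conj f Hf)).
  rewrite (mean_ext _ (fun t =>
     ((f t * Cconj (f t) - Cconj c * (f t * e t)) - (c * Cconj (f t * e t) - c * Cconj c))%C)).
  2:{ intros t.
      assert (E1 : Cconj (e t) = cis (IZR m * t))
        by (unfold e; rewrite cis_conj; f_equal; ring).
      assert (E2 : (e t * cis (IZR m * t) = 1)%C).
      { unfold e. rewrite <- cis_plus, <- cis_0. f_equal. ring. }
      assert (E3 : Cconj (cis (IZR m * t)) = e t)
        by (unfold e; rewrite cis_conj; f_equal; ring).
      rewrite Cminus_conj, !Cmult_conj, E1, E3.
      transitivity (f t * Cconj (f t) - Cconj c * (f t * e t)
         - (c * (Cconj (f t) * cis (IZR m * t)) - c * Cconj c * (e t * cis (IZR m * t))))%C;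
        [ring|rewrite E2; ring]. }
  rewrite mean_minus, !mean_minus, !mean_scal, mean_conj, mean_const.
  1: replace (mean (fun t => (f t * e t)%C)) with c by reflexivity;
     rewrite Cmod2_conj; ring.
  all: repeat first [exact He | exact Hff | apply ccont_const | apply ccont_minus
    | apply ccont_mult | apply ccont_conj].
Qed.

(** Removing the last frequency leaves the other coefficients unchanged and lowers the square mean
    by exactly its share. The injective enumeration [mu] allows the nonnegative frequencies, the
    negative ones, or a single one to be selected. *)
Lemma bessel (mu : nat -> Z) (f : R -> C) (N : nat) :
  (forall i j, mu i = mu j -> i = j) -> ccont f ->
  sum_n (fun j => Cmod (fcoef f (mu j)) ^ 2) N <= mean_sq f.
Proof.
  intros Hmu. revert f. induction N as [|N IH]; intros f Hf.
  - rewrite sum_O. pose proof (mean_sq_remove f (mu 0%nat) Hf) as E.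
    assert (H := mean_sq_nonneg _ (ccont_minus f _ Hf (ccont_cis_scal (fcoef f (mu 0%nat)) (mu 0%nat)))).
    cbv beta in H. rewrite E in H. lra.
  - rewrite sum_Sn. set (c := fcoef f (mu (S N))).
    assert (Hc := ccont_minus f _ Hf (ccont_cis_scal c (mu (S N)))).
    specialize (IH _ Hc). cbv beta in IH. unfold c in IH at 2. rewrite mean_sq_remove in IH by exact Hf.
    fold c in IH. unfold plus; simpl. simpl in IH.
    apply Rplus_le_reg_r with (- (Cmod c * (Cmod c * 1))).
    eapply Rle_trans; [|eapply Rle_trans; [exact IH|lra]].
    apply Rle_trans with
      (sum_n (fun j => Cmod (fcoef f (mu j)) * (Cmod (fcoef f (mu j)) * 1)) N); [lra|].
    right. apply sum_n_ext_loc. intros j Hj.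
    rewrite fcoef_minus, fcoef_cis by (exact Hf || apply ccont_cis_scal).
    destruct (Z.eq_dec (mu j) (mu (S N))) as [h|h]; [apply Hmu in h; lia|].
    replace (fcoef f (mu j) - 0)%C with (fcoef f (mu j)) by ring. reflexivity.
Qed.

(** * Fourier coefficients of a holomorphic function on circles *)

Definition holo_disc (g : C -> C) : Prop := forall z, in_disc z -> exists l, cderiv g z l.

(** Circles are indexed by the logarithm s of the radius: s < 0 sweeps the punctured disc, and the
    power r^m is exp(m s) for integers m of either sign. *)
Definition circle (g : C -> C) (s : R) : R -> C := fun t => g (cexp (s, t)).

Lemma in_disc_cexp (s t : R) : s < 0 -> in_disc (cexp (s, t)).
Proof.
  intros Hs. unfold in_disc. rewrite Cmod_cexp. simpl.
  rewrite <- exp_0. apply exp_increasing, Hs.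
Qed.

Lemma cexp_polar (s t : R) : cexp (s, t) = (RtoC (exp s) * cis t)%C.
Proof. apply C_ext; unfold cis, cexp; simpl; rewrite exp_0; ring. Qed.

Lemma ccont_cexp_vertical (s : R) : ccont (fun t => cexp (s, t)).
Proof.
  intros t. apply (cderiv_ccont_comp cexp (fun t => (s, t)) t _ (cderiv_cexp _)).
  apply ccont_at_vertical.
Qed.

Lemma ccont_circle (g : C -> C) (s : R) : holo_disc g -> s < 0 -> ccont (circle g s).
Proof.
  intros Hg Hs t. destruct (Hg _ (in_disc_cexp s t Hs)) as [l Hl].
  apply (cderiv_ccont_comp g (fun t => cexp (s, t)) t l Hl). apply ccont_cexp_vertical.
Qed.

(* Goursat in the logarithmic coordinate [w = s + i t], on the rectangle
   [s1, s2] x [0, 2 PI]: the horizontal edges cancel by periodicity. *)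
Lemma fcoef_circle_le (g : C -> C) (m : Z) (s1 s2 : R) :
  holo_disc g -> s1 <= s2 -> s2 < 0 ->
  (RtoC (exp (- IZR m * s1)) * fcoef (circle g s1) m)%C =
  (RtoC (exp (- IZR m * s2)) * fcoef (circle g s2) m)%C.
Proof.
  intros Hg H12 Hs2. pose proof two_PI_pos as HP.
  set (F := fun w : C => (g (cexp w) * cexp (RtoC (- IZR m) * w))%C).
  assert (HF : cdiff_rect F s1 s2 0 (2 * PI)).
  { intros s t Hs _. destruct (Hg (cexp (s, t)) (in_disc_cexp s t ltac:(lra))) as [l Hl].
    eexists. apply cderiv_mult.
    - apply (cderiv_comp g cexp); [exact Hl|apply cderiv_cexp].
    - apply (cderiv_comp cexp (fun w => (RtoC (- IZR m) * w)%C)); [apply cderiv_cexp|].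
      pose proof (cderiv_affine 0 (RtoC (- IZR m)) (s, t)) as H.
      intros eps He. destruct (H eps He) as [d [Hd H']]. exists d. split; [exact Hd|].
      intros w Hw. specialize (H' w Hw). rewrite !Cplus_0_l in H'. exact H'. }
  pose proof (goursat F s1 s2 0 (2 * PI) H12 ltac:(lra) HF) as HG.
  assert (Hper : forall s, F (s, 2 * PI) = F (s, 0)).
  { intros s. unfold F.
    replace (cexp (s, 2 * PI)) with (cexp (s, 0)).
    2:{ apply C_ext; unfold cexp; simpl; rewrite ?cos_0, ?sin_0, ?cos_2PI, ?sin_2PI; reflexivity. }
    replace (RtoC (- IZR m) * (s, (2 * PI)%R))%C
      with ((RtoC (- IZR m) * (s, 0)) + (0, (IZR (- m) * (2 * PI))%R))%C
      by (apply C_ext; simpl; rewrite ?opp_IZR; ring).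
    rewrite (cexp_plus _ (0, (IZR (- m) * (2 * PI))%R)).
    fold (cis (IZR (- m) * (2 * PI))). rewrite cis_period. ring. }
  (* On a vertical edge e^(-m w) splits into the radial factor exp(-m s), constant there, and the
     character defining the Fourier coefficient. *)
  assert (HV : forall s, s < 0 -> cint (fun t => F (s, t)) 0 (2 * PI) =
    (RtoC (exp (- IZR m * s)) * (RtoC (2 * PI) * fcoef (circle g s) m))%C).
  { intros s Hs. unfold fcoef, mean.
    rewrite (Cmult_assoc (RtoC (2 * PI))), <- RtoC_mult, Rinv_r by lra.
    rewrite Cmult_1_l.
    rewrite <- (proj2 (cint_scal _ _ 0 (2 * PI)
      (ccont_ex_cint _ (ccont_mul_cis _ (- IZR m) (ccont_circle g s Hg Hs))))).
    apply cint_ext. intros t. unfold F, circle.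
    replace (RtoC (- IZR m) * (s, t))%C with ((- IZR m * s, - IZR m * t) : C)
      by (apply C_ext; simpl; ring).
    rewrite (cexp_polar (- IZR m * s)). ring. }
  unfold rect_int in HG.
  rewrite (cint_ext (fun s => F (s, 2 * PI)) (fun s => F (s, 0))) in HG by exact Hper.
  rewrite !HV in HG by lra.
  assert (HPn : RtoC (2 * PI) <> 0%C) by (intros h; injection h; lra).
  set (X1 := (RtoC (exp (- IZR m * s1)) * fcoef (circle g s1) m)%C).
  set (X2 := (RtoC (exp (- IZR m * s2)) * fcoef (circle g s2) m)%C).
  assert (E : (Ci * RtoC (2 * PI) * (X2 - X1) = 0)%C).
  { rewrite <- HG. unfold X1, X2. ring. }
  apply Ceq_minus. 
  replace (X1 - X2)%C with (- (/ (Ci * RtoC (2 * PI)) * (Ci * RtoC (2 * PI) * (X2 - X1))))%C.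
  - rewrite E. ring.
  - field. split; [exact HPn|apply Ci_nz].
Qed.

(** Normalised on the circle of radius e^-1, where exp(m) is r^-m. The index runs over all integers:
    that negative ones contribute nothing has to be proved. *)
Definition taylor_coef (g : C -> C) (m : Z) : C :=
  (RtoC (exp (IZR m)) * fcoef (circle g (-1)) m)%C.

Lemma fcoef_circle (g : C -> C) (m : Z) (s : R) :
  holo_disc g -> s < 0 ->
  fcoef (circle g s) m = (taylor_coef g m * RtoC (exp (IZR m * s)))%C.
Proof.
  intros Hg Hs.
  assert (E : (RtoC (exp (- IZR m * s)) * fcoef (circle g s) m)%C = taylor_coef g m).
  { unfold taylor_coef. replace (IZR m) with (- IZR m * -1) at 2 by ring.
    destruct (Rle_or_lt s (-1)) as [h|h].
    - apply fcoef_circle_le; [exact Hg|exact h|lra].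
    - symmetry. apply fcoef_circle_le; [exact Hg|lra|lra]. }
  rewrite <- E.
  replace (RtoC (exp (- IZR m * s)) * fcoef (circle g s) m * RtoC (exp (IZR m * s)))%C
    with (RtoC (exp (- IZR m * s) * exp (IZR m * s)) * fcoef (circle g s) m)%C
    by (rewrite RtoC_mult; ring).
  rewrite <- exp_plus. replace (- IZR m * s + IZR m * s) with 0 by ring.
  rewrite exp_0. ring.
Qed.

Lemma exp_le_compat (x y : R) : x <= y -> exp x <= exp y.
Proof.
  intros [h| ->]; [apply Rlt_le, exp_increasing, h|apply Rle_refl].
Qed.

(** Bessel with one term gives |d_m|^2 r^(2m) <= B, and for m < 0 the power of r is unbounded as the
    radius tends to 0. *)
Lemma taylor_coef_neg (g : C -> C) (B : R) (m : Z) :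
  holo_disc g -> (forall s, s < 0 -> mean_sq (circle g s) <= B) ->
  (m < 0)%Z -> taylor_coef g m = 0%C.
Proof.
  intros Hg HB Hm. apply Cmod_eq_0.
  assert (H : forall x, 0 < x -> Cmod (taylor_coef g m) ^ 2 * (1 + x) <= B).
  { intros x Hx.
    assert (Hs : - x < 0) by lra.
    pose proof (bessel (fun j => (m + Z.of_nat j)%Z) (circle g (- x)) 0
      ltac:(cbv beta; intros; lia) (ccont_circle g _ Hg Hs)) as Hbes.
    rewrite sum_O in Hbes. change (Z.of_nat 0) with 0%Z in Hbes. rewrite Z.add_0_r in Hbes.
    rewrite (fcoef_circle g m _ Hg Hs), Cmod_mult, Cmod_R in Hbes.
    rewrite Rabs_pos_eq in Hbes by (apply Rlt_le, exp_pos).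
    assert (Hm' : IZR m <= -1) by (apply IZR_le; lia).
    assert (He : 1 + x <= exp (IZR m * - x)).
    { eapply Rle_trans; [apply exp_ineq1_le|]. apply exp_le_compat. nra. }
    eapply Rle_trans; [|eapply Rle_trans; [exact Hbes|apply HB, Hs]].
    rewrite Rpow_mult_distr. apply Rmult_le_compat_l; [apply pow2_ge_0|]. nra. }
  set (y := Cmod (taylor_coef g m)) in *.
  assert (Hy : 0 <= y) by apply Cmod_ge_0.
  destruct (Req_dec y 0) as [h|h]; [exact h|exfalso].
  assert (Hy2 : 0 < y ^ 2) by (apply pow_lt; lra).
  assert (HB0 : 0 <= B) by (specialize (H 1 Rlt_0_1); nra).
  (* This choice turns the bound into 2 y^2 + B <= B. *)
  specialize (H (B / y ^ 2 + 1)).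
  assert (0 <= B / y ^ 2) by (apply Rle_mult_inv_pos; lra).
  specialize (H ltac:(lra)).
  replace (y ^ 2 * (1 + (B / y ^ 2 + 1))) with (2 * y ^ 2 + B) in H by (field; lra).
  lra.
Qed.

Lemma sum_n_le_loc (u v : nat -> R) (N : nat) :
  (forall j, (j <= N)%nat -> u j <= v j) -> sum_n u N <= sum_n v N.
Proof.
  induction N as [|N IH]; intros H.
  - rewrite !sum_O. apply H. lia.
  - rewrite !sum_Sn. apply Rplus_le_compat; [|apply H; lia].
    apply IH. intros j Hj. apply H. lia.
Qed.

(** Bessel bounds the sum of |d_j|^2 r^(2j). Up to index N each weight is at least r^(2N), and r
    tends to 1 with N fixed. *)
Lemma taylor_coef_l2le (g : C -> C) (B : R) :
  holo_disc g -> (forall s, s < 0 -> mean_sq (circle g s) <= B) ->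
  l2le (fun j => taylor_coef g (Z.of_nat j)) (sqrt B).
Proof.
  intros Hg HB. split; [apply sqrt_pos|]. intros N.
  assert (HB0 : 0 <= B).
  { eapply Rle_trans; [|apply (HB (-1)); lra]. apply mean_sq_nonneg, ccont_circle; [exact Hg|lra]. }
  rewrite pow2_sqrt by exact HB0.
  set (S0 := sum_n (fun j => Cmod (taylor_coef g (Z.of_nat j)) ^ 2) N).
  assert (HS0 : 0 <= S0) by (apply sum_n_nonneg; intros; apply pow2_ge_0).
  assert (H : forall x, 0 < x -> S0 * exp (- (2 * INR N * x)) <= B).
  { intros x Hx. assert (Hs : - x < 0) by lra.
    eapply Rle_trans; [|apply (HB _ Hs)].
    eapply Rle_trans; [|apply (bessel Z.of_nat _ N ltac:(intros; lia) (ccont_circle g _ Hg Hs))].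
    unfold S0. rewrite Rmult_comm, <- sum_n_Rmult.
    apply sum_n_le_loc. intros j Hj.
    rewrite (fcoef_circle g _ _ Hg Hs), Cmod_mult, Cmod_R, Rpow_mult_distr.
    rewrite (Rabs_pos_eq (exp _)) by (apply Rlt_le, exp_pos).
    rewrite Rmult_comm. apply Rmult_le_compat_l; [apply pow2_ge_0|].
    rewrite <- Rsqr_pow2. unfold Rsqr. rewrite <- exp_plus. apply exp_le_compat.
    rewrite <- INR_IZR_INZ. apply le_INR in Hj. nra. }
  apply Rle_plus_eps. intros eps He.
  (* As exp(-y) >= 1 - y, the weight loses at most 2 N x S0, which this choice keeps below eps. *)
  set (x := eps / (2 * INR N * S0 + 1)).
  pose proof (pos_INR N) as HN.
  assert (HNS : 0 <= 2 * INR N * S0) by (repeat apply Rmult_le_pos; lra).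
  assert (Hx : 0 < x) by (apply Rdiv_lt_0_compat; lra).
  specialize (H x Hx).
  pose proof (exp_ineq1_le (- (2 * INR N * x))) as He1.
  assert (Hprod : 2 * INR N * S0 * x <= eps).
  { unfold x. replace eps with (eps / (2 * INR N * S0 + 1) * (2 * INR N * S0 + 1)) at 2 by (field; lra).
    fold x. rewrite (Rmult_comm _ x). apply Rmult_le_compat_l; lra. }
  apply Rmult_le_compat_l with (r := S0) in He1; [|exact HS0]. lra.
Qed.

(** * Convergence of the Taylor series *)

Lemma ccont_at_ext_loc (f g : R -> C) (t delta : R) :
  0 < delta -> (forall u, Rabs (u - t) < delta -> f u = g u) -> ccont_at f t -> ccont_at g t.
Proof.
  intros Hdl E H eps He. destruct (H eps He) as [d [Hd H']].
  exists (Rmin d delta). split; [apply Rmin_glb_lt; assumption|]. intros u Hu.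
  rewrite <- !E.
  - apply H'. eapply Rlt_le_trans; [exact Hu|apply Rmin_l].
  - rewrite Rminus_diag, Rabs_R0. exact Hdl.
  - eapply Rlt_le_trans; [exact Hu|apply Rmin_r].
Qed.

Lemma ccont_at_nonzero (f : R -> C) (t : R) :
  ccont_at f t -> f t <> 0%C -> exists delta, 0 < delta /\
    forall u, Rabs (u - t) < delta -> Cmod (f t) / 2 < Cmod (f u).
Proof.
  intros Hf Hn. apply Cmod_gt_0 in Hn.
  destruct (Hf (Cmod (f t) / 2)) as [d [Hd H]]; [lra|].
  exists d. split; [exact Hd|]. intros u Hu. specialize (H u Hu).
  pose proof (Cmod_triangle_sub (f u) (f u - f t)%C) as T.
  replace (f u - (f u - f t))%C with (f t) in T by ring. lra.
Qed.

Lemma ccont_at_inv (f : R -> C) (t : R) :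
  ccont_at f t -> f t <> 0%C -> ccont_at (fun u => (/ f u)%C) t.
Proof.
  intros Hf Hn eps He. pose proof (proj1 (Cmod_gt_0 _) Hn) as Hp.
  destruct (ccont_at_nonzero f t Hf Hn) as [d1 [Hd1 H1]].
  set (A := Cmod (f t)) in *.
  destruct (Hf (eps * (A * A / 2))) as [d2 [Hd2 H2]].
  { apply Rmult_lt_0_compat; [exact He|]. nra. }
  exists (Rmin d1 d2). split; [apply Rmin_glb_lt; assumption|]. intros u Hu.
  specialize (H1 u (Rlt_le_trans _ _ _ Hu (Rmin_l _ _))).
  specialize (H2 u (Rlt_le_trans _ _ _ Hu (Rmin_r _ _))).
  assert (Hu0 : f u <> 0%C) by (apply Cmod_gt_0; lra).
  replace (/ f u - / f t)%C with (- (f u - f t) / (f u * f t))%C by (field; split; assumption).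
  rewrite Cmod_div by (apply Cmult_neq_0; assumption).
  rewrite Cmod_opp, Cmod_mult. fold A.
  apply Rlt_div_l; [apply Rmult_lt_0_compat; lra|].
  eapply Rlt_le_trans; [exact H2|]. apply Rmult_le_compat_l; [lra|]. nra.
Qed.

(** The quotient takes the derivative as its value at [z0]; where the circle meets [z0], continuity
    is precisely differentiability of [g] there. *)
Lemma ccont_difference_quotient (g : C -> C) (s : R) (z0 : C) :
  holo_disc g -> s < 0 -> in_disc z0 ->
  exists q, ccont q /\ forall t, (circle g s t - g z0 = (cexp (s, t) - z0) * q t)%C.
Proof.
  intros Hg Hs Hz0. destruct (Hg z0 Hz0) as [l Hl].
  set (Q := fun z => if Ceq_dec z z0 then l else ((g z - g z0) / (z - z0))%C).
  exists (fun t => Q (cexp (s, t))). split.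
  - intros t. assert (Hc := ccont_cexp_vertical s t).
    destruct (Ceq_dec (cexp (s, t)) z0) as [h|h].
    + intros eps He. destruct (Hl (eps / 2)) as [d [Hd H]]; [lra|].
      destruct (Hc d Hd) as [d' [Hd' H']]. exists d'. split; [exact Hd'|].
      intros u Hu. specialize (H' u Hu). rewrite h in *. specialize (H _ H').
      unfold Q. destruct (Ceq_dec z0 z0) as [_|hn]; [|contradiction].
      set (w := cexp (s, u)) in *.
      destruct (Ceq_dec w z0) as [hw|hw].
      * replace (l - l)%C with (RtoC 0) by ring. rewrite Cmod_0. exact He.
      * assert (Hw : (w - z0)%C <> 0%C) by (apply Cminus_eq_contra; exact hw).
        replace ((g w - g z0) / (w - z0) - l)%C
          with ((g w - g z0 - l * (w - z0)) / (w - z0))%C by (field; exact Hw).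
        rewrite Cmod_div by exact Hw. apply Cmod_gt_0 in Hw.
        apply Rle_lt_trans with (eps / 2); [|lra].
        apply Rle_div_l; [exact Hw|exact H].
    + assert (Hz : (cexp (s, t) - z0)%C <> 0%C) by (apply Cminus_eq_contra; exact h).
      assert (Hz' : ccont_at (fun u => (cexp (s, u) - z0)%C) t)
        by (apply ccont_minus; [apply ccont_cexp_vertical|apply ccont_const]).
      destruct (ccont_at_nonzero _ t Hz' Hz) as [d [Hd H]].
      apply ccont_at_ext_loc with (fun u => ((circle g s u - g z0) * / (cexp (s, u) - z0))%C) d.
      * exact Hd.
      * intros u Hu. specialize (H u Hu). unfold Q.
        destruct (Ceq_dec (cexp (s, u)) z0) as [hu|hu]; [|reflexivity].
        rewrite hu in H. replace (z0 - z0)%C with (RtoC 0) in H by ring.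
        rewrite Cmod_0 in H. pose proof (Cmod_ge_0 (cexp (s, t) - z0)%C). lra.
      * apply ccont_at_mult.
        -- apply ccont_minus; [apply ccont_circle; assumption|apply ccont_const].
        -- apply ccont_at_inv; assumption.
  - intros t. unfold Q, circle. destruct (Ceq_dec (cexp (s, t)) z0) as [h|h].
    + rewrite h. ring.
    + field. apply Cminus_eq_contra. exact h.
Qed.

Lemma sum_n_Rconst (k : R) (N : nat) : sum_n (fun _ => k) N = INR (S N) * k.
Proof.
  induction N as [|N IH].
  - rewrite sum_O. simpl. ring.
  - rewrite sum_Sn, IH, (S_INR (S N)). unfold plus; simpl. ring.
Qed.

(* Chernoff's argument: with [g - g z0 = (z - z0) q] on the circle through [z0],
   the partial sums telescope to a multiple of a Fourier coefficient of [q]. *)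
Lemma taylor_series_nonzero (g : C -> C) (B : R) (z0 : C) :
  holo_disc g -> (forall s, s < 0 -> mean_sq (circle g s) <= B) ->
  in_disc z0 -> z0 <> 0%C ->
  is_series (powser (fun j => taylor_coef g (Z.of_nat j)) z0) (g z0).
Proof.
  intros Hg HB Hz0 Hn. pose proof (proj1 (Cmod_gt_0 _) Hn) as Hr.
  set (r := Cmod z0) in *. set (s := ln r).
  assert (Hs : s < 0) by (rewrite <- ln_1; apply ln_increasing; [exact Hr|exact Hz0]).
  assert (Her : exp s = r) by (apply exp_ln; exact Hr).
  destruct (ccont_difference_quotient g s z0 Hg Hs Hz0) as [q [Hq Hqe]].
  assert (Hrn : RtoC r <> 0%C) by (intros h; injection h; lra).
  (* Fourier coefficients of both sides of g - g(z0) = (z - z0) q: on the circle z is r e^(it),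
     which shifts the frequency by one. *)
  assert (Hm : forall m : Z,
    (taylor_coef g m * RtoC (exp (IZR m * s)) - (if Z.eq_dec m 0 then g z0 else 0))%C =
    (RtoC r * fcoef q (m - 1) - z0 * fcoef q m)%C).
  { intros m.
    assert (Hsh : ccont (fun t => (cis (IZR 1 * t) * q t)%C))
      by (apply ccont_mult; [apply ccont_cis|exact Hq]).
    rewrite <- (fcoef_circle g m s Hg Hs), <- fcoef_const, <- fcoef_shift.
    rewrite <- (fcoef_scal (RtoC r)), <- (fcoef_scal z0) by assumption.
    rewrite <- !fcoef_minus.
    - apply fcoef_ext. intros t. rewrite Hqe, cexp_polar, Her, Rmult_1_l. ring.
    - apply ccont_mult; [apply ccont_const|exact Hsh].
    - apply ccont_mult; [apply ccont_const|exact Hq].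
    - apply ccont_circle; assumption.
    - apply ccont_const. }
  assert (Hneg : fcoef q (-1) = 0%C).
  { apply Cmod_eq_0.
    (* For m < 0 the left side of [Hm] vanishes, and |z0| = r makes the coefficients of [q] at
       negative frequencies all equal in modulus; Bessel then forces them to be 0. *)
    assert (Hc : forall j : nat, Cmod (fcoef q (-1 - Z.of_nat j)) = Cmod (fcoef q (-1))).
    { induction j as [|j IH]; [reflexivity|]. rewrite <- IH.
      set (m := (-1 - Z.of_nat j)%Z).
      replace (-1 - Z.of_nat (S j))%Z with (m - 1)%Z by (unfold m; lia).
      specialize (Hm m). rewrite (taylor_coef_neg g B m Hg HB) in Hm by (unfold m; lia).
      destruct (Z.eq_dec m 0) as [h|_]; [unfold m in h; lia|].
      assert (E : (RtoC r * fcoef q (m - 1) = z0 * fcoef q m)%C).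
      { apply Ceq_minus. rewrite <- Hm. ring. }
      apply (f_equal Cmod) in E. rewrite !Cmod_mult, Cmod_R, Rabs_pos_eq in E by lra.
      fold r in E. apply Rmult_eq_reg_l in E; lra. }
    set (y := Cmod (fcoef q (-1))) in *.
    assert (Hy : 0 <= y) by apply Cmod_ge_0.
    assert (Hb : forall N, INR (S N) * y ^ 2 <= mean_sq q).
    { intros N. rewrite <- sum_n_Rconst.
      rewrite (sum_n_ext _ (fun j => Cmod (fcoef q (-1 - Z.of_nat j)) ^ 2))
        by (intros j; rewrite Hc; reflexivity).
      apply (bessel (fun j => (-1 - Z.of_nat j)%Z)); [intros; lia|exact Hq]. }
    destruct (Req_dec y 0) as [h|h]; [exact h|exfalso].
    assert (Hy2 : 0 < y ^ 2) by (apply pow_lt; lra).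
    destruct (INR_unbounded (mean_sq q / y ^ 2)) as [N HN].
    specialize (Hb N). apply Rlt_div_l in HN; [|exact Hy2]. rewrite S_INR in Hb. lra. }
  set (u := (z0 / RtoC r)%C).
  assert (Hz0u : z0 = (RtoC r * u)%C) by (unfold u; field; exact Hrn).
  assert (Hu1 : Cmod u = 1).
  { unfold u. rewrite Cmod_div, Cmod_R, Rabs_pos_eq by (lra || exact Hrn). fold r. field. lra. }
  assert (Hpow : forall j, Cpown z0 j = (RtoC (exp (IZR (Z.of_nat j) * s)) * Cpown u j)%C).
  { induction j as [|j IH].
    - simpl. rewrite Rmult_0_l, exp_0. ring.
    - simpl Cpown. rewrite IH, Nat2Z.inj_succ, succ_IZR, Rmult_plus_distr_r, exp_plus,
        Rmult_1_l, Her, RtoC_mult. rewrite Hz0u at 1. ring. }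
  (* Multiplying [Hm] by u^j, with u = z0 / r unimodular, makes the right sides telescope; [Hneg]
     removes the lower boundary term. *)
  assert (Hsum : forall N, sum_n (powser (fun j => taylor_coef g (Z.of_nat j)) z0) N =
     (g z0 - RtoC r * (Cpown u (S N) * fcoef q (Z.of_nat N)))%C).
  { assert (Hterm : forall j, powser (fun j => taylor_coef g (Z.of_nat j)) z0 j =
      (Cpown u j * ((if Z.eq_dec (Z.of_nat j) 0 then g z0 else 0) +
        (RtoC r * fcoef q (Z.of_nat j - 1) - z0 * fcoef q (Z.of_nat j))))%C).
    { intros j. rewrite <- Hm. unfold powser. rewrite Hpow. ring. }
    induction N as [|N IH].
    - rewrite sum_O, Hterm. simpl (Z.of_nat 0). simpl (0 - 1)%Z. rewrite Hneg.
      destruct (Z.eq_dec 0 0) as [_|h]; [|lia]. simpl. rewrite Hz0u at 2. Cring.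
    - rewrite sum_Sn, IH, Hterm.
      destruct (Z.eq_dec (Z.of_nat (S N)) 0) as [h|_]; [lia|].
      replace (Z.of_nat (S N) - 1)%Z with (Z.of_nat N) by lia.
      unfold plus; simpl Cpown. rewrite Hz0u at 2. simpl. Cring. }
  apply is_Cseries_eps. intros eps He.
  (* Bessel for [q] sends the upper boundary term, of modulus r |q_N|, to 0. *)
  assert (Hex : ex_series (fun j => Cmod (fcoef q (Z.of_nat j)) ^ 2)).
  { apply ex_series_bounded with (mean_sq q); [intros; apply pow2_ge_0|].
    intros N. apply bessel; [intros; lia|exact Hq]. }
  apply ex_series_lim_0 in Hex. apply is_lim_seq_spec in Hex.
  assert (He2 : 0 < eps ^ 2) by (apply pow_lt; exact He).
  destruct (Hex (mkposreal _ He2)) as [N HN]. exists N. intros k Hk.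
  specialize (HN k Hk). simpl in HN. rewrite Rminus_0_r in HN.
  rewrite Hsum.
  replace (g z0 - RtoC r * (Cpown u (S k) * fcoef q (Z.of_nat k)) - g z0)%C
    with (- (RtoC r * (Cpown u (S k) * fcoef q (Z.of_nat k))))%C by ring.
  rewrite Cmod_opp, !Cmod_mult, Cmod_R, Cmod_pown, Hu1, pow1, Rmult_1_l, Rabs_pos_eq by lra.
  set (x := Cmod (fcoef q (Z.of_nat k))) in *.
  assert (0 <= x) by apply Cmod_ge_0.
  rewrite Rabs_pos_eq in HN by nra.
  assert (x < eps) by nra.
  unfold in_disc in Hz0. fold r in Hz0. nra.
Qed.

Theorem holo_mean_sq_in_H2 (g : C -> C) (B : R) :
  holo_disc g -> (forall s, s < 0 -> mean_sq (circle g s) <= B) -> in_H2 g.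
Proof.
  intros Hg HB. set (d := fun j => taylor_coef g (Z.of_nat j)).
  assert (Hd : l2le d (sqrt B)) by (apply taylor_coef_l2le; assumption).
  exists d, (sqrt B). split; [exact Hd|]. intros z Hz.
  destruct (Ceq_dec z 0) as [->|hz]; [|apply taylor_series_nonzero with B; assumption].
  (* No logarithmic radius reaches 0. There the sum of the series and [g] are both continuous and
     agree at small positive [x], so they agree at 0. *)
  set (G := fun z => Csum (powser d z)).
  assert (HG := powser_correct d (sqrt B) 0 (l2le_bounded _ _ Hd) Hz). fold (G 0%C) in HG.
  replace (g 0%C) with (G 0%C); [exact HG|].
  destruct (cderiv_powser d (sqrt B) 0 (l2le_bounded _ _ Hd) Hz) as [l1 H1].
  destruct (Hg 0%C Hz) as [l2 H2].
  apply Ceq_minus, Cmod_eq_0, Rle_antisym; [|apply Cmod_ge_0].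
  apply Rle_plus_eps. intros eps He. rewrite Rplus_0_l.
  destruct (cderiv_cont _ _ _ H1 (eps / 2)) as [d1 [Hd1 K1]]; [lra|].
  destruct (cderiv_cont _ _ _ H2 (eps / 2)) as [d2 [Hd2 K2]]; [lra|].
  set (x := Rmin (1 / 2) (Rmin d1 d2 / 2)).
  assert (Hm : 0 < Rmin d1 d2) by (apply Rmin_glb_lt; assumption).
  assert (Hx0 : 0 < x) by (apply Rmin_glb_lt; lra).
  assert (Hx1 : x <= 1 / 2) by apply Rmin_l.
  assert (Hx2 : x <= Rmin d1 d2 / 2) by apply Rmin_r.
  pose proof (Rmin_l d1 d2). pose proof (Rmin_r d1 d2).
  assert (Hxm : Cmod (RtoC x) = x) by (rewrite Cmod_R; apply Rabs_pos_eq; lra).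
  assert (Hxs : Cmod (RtoC x - 0)%C = x) by (rewrite <- Hxm at 2; f_equal; ring).
  specialize (K1 (RtoC x)). specialize (K2 (RtoC x)). rewrite Hxs in K1, K2.
  specialize (K1 ltac:(lra)). specialize (K2 ltac:(lra)).
  assert (HE : Csum (powser d (RtoC x)) = g (RtoC x)).
  { apply Csum_eq, taylor_series_nonzero with B; try assumption.
    - unfold in_disc. rewrite Hxm. lra.
    - intros h. injection h. lra. }
  rewrite HE in K1.
  replace (G 0%C - g 0%C)%C
    with ((g (RtoC x) - g 0%C) - (g (RtoC x) - G 0%C))%C by ring.
  eapply Rle_trans; [apply Cmod_triangle_sub|]. unfold G. lra.
Qed.

(** * Square means of Hardy space functions *)

Definition trig_poly (a : nat -> C) (N : nat) (t : R) : C :=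
  sum_n (fun m => (a m * cis (IZR (Z.of_nat m) * t))%C) N.

Lemma trig_poly_S (a : nat -> C) (N : nat) (t : R) :
  trig_poly a (S N) t = (trig_poly a N t + a (S N) * cis (IZR (Z.of_nat (S N)) * t))%C.
Proof. unfold trig_poly. rewrite sum_Sn. reflexivity. Qed.

Lemma ccont_ext (f g : R -> C) : (forall t, f t = g t) -> ccont f -> ccont g.
Proof.
  intros E H t. apply ccont_at_ext_loc with f 1; [lra|intros; apply E|apply H].
Qed.

Lemma ccont_trig_poly (a : nat -> C) (N : nat) : ccont (trig_poly a N).
Proof.
  induction N as [|N IH].
  - apply ccont_ext with (2 := ccont_cis_scal (a 0%nat) (Z.of_nat 0)).
    intros t. unfold trig_poly. rewrite sum_O. reflexivity.
  - apply ccont_ext with (2 := ccont_plus _ _ IH (ccont_cis_scal (a (S N)) (Z.of_nat (S N)))).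
    intros t. symmetry. apply trig_poly_S.
Qed.

Lemma fcoef_trig_poly (a : nat -> C) (N : nat) (m : Z) :
  (Z.of_nat N < m)%Z -> fcoef (trig_poly a N) m = 0%C.
Proof.
  intros Hm. induction N as [|N IH].
  - rewrite (fcoef_ext _ (fun t => (a 0%nat * cis (IZR (Z.of_nat 0) * t))%C))
      by (intros t; unfold trig_poly; rewrite sum_O; reflexivity).
    rewrite fcoef_cis. destruct (Z.eq_dec m (Z.of_nat 0)); [lia|reflexivity].
  - rewrite (fcoef_ext _ _ m (trig_poly_S a N)).
    rewrite fcoef_plus, fcoef_cis, IH by (lia || apply ccont_trig_poly || apply ccont_cis_scal).
    destruct (Z.eq_dec m (Z.of_nat (S N))); [lia|]. ring.
Qed.

(** The top frequency is peeled off with [mean_sq_remove]; the base case has constant modulus. *)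
Lemma mean_sq_trig_poly (a : nat -> C) (N : nat) :
  mean_sq (trig_poly a N) <= sum_n (fun m => Cmod (a m) ^ 2) N.
Proof.
  induction N as [|N IH].
  - rewrite sum_O.
    pose proof (mean_sq_lincomb_le (trig_poly a 0) (trig_poly a 0) 0 (Cmod (a 0%nat) ^ 2)
      (ccont_trig_poly a 0) (ccont_trig_poly a 0)) as H.
    eapply Rle_trans; [apply H|lra].
    intros t. unfold trig_poly. rewrite sum_O, Cmod_mult, Cmod_cis. nra.
  - rewrite sum_Sn. set (m := Z.of_nat (S N)).
    assert (Hf : fcoef (trig_poly a (S N)) m = a (S N)).
    { rewrite (fcoef_ext _ _ m (trig_poly_S a N)).
      rewrite fcoef_plus, fcoef_cis, fcoef_trig_poly
        by (unfold m; lia || apply ccont_trig_poly || apply ccont_cis_scal).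
      fold m. destruct (Z.eq_dec m m); [ring|contradiction]. }
    pose proof (mean_sq_remove (trig_poly a (S N)) m (ccont_trig_poly a (S N))) as E.
    rewrite Hf in E.
    assert (E2 : mean_sq (fun t => (trig_poly a (S N) t - a (S N) * cis (IZR m * t))%C)
      = mean_sq (trig_poly a N)).
    { unfold mean_sq. f_equal. apply RInt_ext. intros t _. do 2 f_equal.
      rewrite trig_poly_S. fold m. ring. }
    rewrite E2 in E. unfold plus; simpl. simpl in E, IH. lra.
Qed.

(** On a fixed circle the series is uniformly within 1 of a partial sum, and (y + 1)^2 <= 2 y^2 + 2.
    The constant is crude; what matters is that it does not depend on [s]. *)
Lemma mean_sq_H2 (c : nat -> C) (K s : R) :
  l2le c K -> s < 0 ->
  mean_sq (circle (fun z => Csum (powser c z)) s) <= 2 * K ^ 2 + 2.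
Proof.
  intros HK Hs. pose proof (l2le_bounded _ _ HK) as Hc.
  assert (HK0 : 0 <= K) by apply HK.
  set (r := exp s). assert (Hr : 0 < r < 1).
  { split; [apply exp_pos|]. unfold r. rewrite <- exp_0. apply exp_increasing, Hs. }
  set (a := fun m => (c m * RtoC (r ^ m))%C).
  assert (Hpow : forall t m, powser c (cexp (s, t)) m = (a m * cis (IZR (Z.of_nat m) * t))%C).
  { intros t m. unfold powser, a.
    assert (E : Cpown (cexp (s, t)) m = (RtoC (r ^ m) * cis (IZR (Z.of_nat m) * t))%C).
    { induction m as [|m IH].
      - simpl. rewrite Rmult_0_l, cis_0. ring.
      - simpl Cpown. rewrite IH, Nat2Z.inj_succ, succ_IZR, Rmult_plus_distr_r, cis_plus,
          Rmult_1_l, cexp_polar. simpl pow. rewrite RtoC_mult. fold r. ring. }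
    rewrite E. ring. }
  (* [N] depends on the radius: the remainder r^(N+1) K / (1 - r) is to be at most 1. *)
  destruct (pow_lt_1_zero r) with (y := (1 - r) / (K + 1)) as [N HN].
  { rewrite Rabs_pos_eq; lra. } { apply Rdiv_lt_0_compat; lra. }
  specialize (HN (S N) ltac:(lia)). rewrite Rabs_pos_eq in HN by (apply pow_le; lra).
  assert (Happrox : forall t,
    Cmod (circle (fun z => Csum (powser c z)) s t - trig_poly a N t)%C <= 1).
  { intros t. unfold circle.
    assert (Hd := in_disc_cexp s t Hs).
    assert (Hmod : Cmod (cexp (s, t)) = r) by (rewrite Cmod_cexp; reflexivity).
    rewrite (powser_tail_split c K _ N Hc Hd).
    assert (E : sum_n (powser c (cexp (s, t))) N = trig_poly a N t)
      by (apply sum_n_ext; intros m; apply Hpow).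
    rewrite E.
    replace (trig_poly a N t + Cpown (cexp (s, t)) (S N) * powser_tail c (cexp (s, t)) (S N)
       - trig_poly a N t)%C
      with (Cpown (cexp (s, t)) (S N) * powser_tail c (cexp (s, t)) (S N))%C by ring.
    rewrite Cmod_mult, Cmod_pown, Hmod.
    pose proof (powser_tail_bound c K _ Hc Hd (S N)) as Hb. rewrite Hmod in Hb.
    apply Rle_trans with ((1 - r) / (K + 1) * (K / (1 - r))).
    - apply Rmult_le_compat; [apply pow_le; lra|apply Cmod_ge_0|lra|exact Hb].
    - replace ((1 - r) / (K + 1) * (K / (1 - r))) with (K / (K + 1)) by (field; lra).
      apply Rle_div_l; lra. }
  assert (Hholo : holo_disc (fun z => Csum (powser c z)))
    by (intros z Hz; apply (cderiv_powser c K z Hc Hz)).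
  apply Rle_trans with (2 * mean_sq (trig_poly a N) + 2).
  - apply mean_sq_lincomb_le; [apply ccont_circle; assumption|apply ccont_trig_poly|].
    intros t. specialize (Happrox t).
    set (x := circle (fun z => Csum (powser c z)) s t) in *. set (y := trig_poly a N t) in *.
    pose proof (Cmod_triangle y (x - y)%C) as T.
    replace (y + (x - y))%C with x in T by ring.
    pose proof (Cmod_ge_0 x). pose proof (Cmod_ge_0 y). pose proof (Cmod_ge_0 (x - y)%C).
    assert (Cmod x <= Cmod y + 1) by lra.
    pose proof (pow2_ge_0 (Cmod y - 1)). nra.
  - apply Rplus_le_compat_r, Rmult_le_compat_l; [lra|].
    eapply Rle_trans; [apply mean_sq_trig_poly|].
    eapply Rle_trans; [|apply (proj2 HK N)].
    apply sum_n_le_loc. intros m _. unfold a.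
    rewrite Cmod_mult, Cmod_R, Rabs_pos_eq by (apply pow_le; lra).
    assert (r ^ m <= 1) by (rewrite <- (pow1 m); apply pow_incr; lra).
    assert (0 <= r ^ m) by (apply pow_le; lra).
    apply pow_incr. pose proof (Cmod_ge_0 (c m)). nra.
Qed.

(** * Bounded holomorphic functions are multipliers *)

Lemma Hinfty_H2_multiplier (phi : C -> C) :
  in_Hinfty phi -> forall g, in_H2 g -> in_H2 (fun z => (phi z * g z)%C).
Proof.
  intros [Hd [M HM]] g [c [K [HK Hc]]].
  pose proof (l2le_bounded _ _ HK) as Hb.
  (* The sum of the series stands in for [g]: it is visibly differentiable on the disc and equals
     [g] there. *)
  set (f := fun z => Csum (powser c z)).
  assert (Hf : holo_disc f) by (intros z Hz; apply (cderiv_powser c K z Hb Hz)).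
  assert (Hh : holo_disc (fun z => (phi z * f z)%C)).
  { intros z Hz. destruct (Hd z Hz) as [l Hl]. destruct (Hf z Hz) as [k Hk].
    eexists. apply cderiv_mult; [apply cderiv_is_derive, Hl|exact Hk]. }
  (* The bound has the shape p X + q of [mean_sq_lincomb_le] with p = M^2 and q = 0, since |phi f|^2
     <= M^2 |f|^2 on every circle. *)
  destruct (holo_mean_sq_in_H2 (fun z => (phi z * f z)%C) (M ^ 2 * (2 * K ^ 2 + 2) + 0) Hh)
    as [d [L [HL HdL]]].
  - intros s Hs.
    apply Rle_trans with (M ^ 2 * mean_sq (circle f s) + 0).
    + apply mean_sq_lincomb_le; [apply ccont_circle; assumption|apply ccont_circle; assumption|].
      intros t. unfold circle. rewrite Cmod_mult, Rpow_mult_distr, Rplus_0_r.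
      apply Rmult_le_compat_r; [apply pow2_ge_0|]. apply pow_incr.
      split; [apply Cmod_ge_0|apply HM, in_disc_cexp, Hs].
    + apply Rplus_le_compat_r, Rmult_le_compat_l; [apply pow2_ge_0|].
      apply mean_sq_H2; assumption.
  - exists d, L. split; [exact HL|]. intros z Hz.
    rewrite <- (Csum_eq _ _ (Hc z Hz)). apply HdL, Hz.
Qed.

Theorem theorem4p4 (n : nat) (hn : (1 <= n)%nat) (b : nat -> C)
  (hb : forall t : nat, (n <= t)%nat -> b t = 0%C) (phi : C -> C) :
  is_multiplier b phi <-> in_Hinfty phi.
Proof.
  split.
  - intros H. apply H2_multiplier_Hinfty. intros g Hg.
    apply (in_trunc_space_H2 n b _ hb), H, (in_trunc_space_H2 n b _ hb), Hg.
  - intros H g Hg. apply (in_trunc_space_H2 n b _ hb).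
    apply (Hinfty_H2_multiplier phi H). apply (in_trunc_space_H2 n b _ hb), Hg.
Qed.
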